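(* Let $d,k\ge 1$ and let $F\in M_k(\mathbb C)\otimes \mathbb C\langle x_1,\dots,x_d\rangle$ be a $k\times k$-matrix valued free polynomial. Let $(P_n)$ denote the sequence of optimal polynomial approximants of $F^{-1}$ (so $P_n$ is a $k\times k$-matrix valued free polynomial of degree at most $n$ minimizing $\|PF-I\|_2$ among all $k\times k$-matrix valued free polynomials $P$ of degree at most $n$), and put $$c_n:=\|P_nF-I\|_2^2 .$$ Then: (1) $c_n\to 0$ as $n\to\infty$ if and only if $F$ is nonsingular in the row ball. (2) If $F$ is nonsingular in the row ball, then there is some $p>0$ depending on $F$ such that $c_n\lesssim \frac{1}{n^p}$. In particular, if $F$ is a product of $\ell$ atomic factors, one can take $p=\frac{1}{3^{\ell-1}}$.
   Context: $\mathbb C\langle x_1,\dots,x_d\rangle$ is the free algebra in freely noncommuting indeterminates $x_1,\dots,x_d$; its elements are free polynomials. For a word $w=i_1\cdots i_m$ in the letters $1,\dots,d$ put $x^w=x_{i_1}\cdots x_{i_m}$ (with $x^\varnothing=1$). A matrix-valued free polynomial is a finite sum $P=\sum_w P_w x^w$ with matrix coefficients $P_w\in M_k(\mathbb C)$; its degree is the maximum length of words $w$ with $P_w\neq0$. Matrix-valued free polynomials are multiplied by multiplying coefficients and concatenating words, so that $M_k(\mathbb C)\otimes\mathbb C\langle x_1,\dots,x_d\rangle$ is identified with $M_k(\mathbb C\langle x_1,\dots,x_d\rangle)$. The norm is $\|P\|_2=\big(\sum_w \mathrm{tr}(P_w^*P_w)\big)^{1/2}$. $I$ is the constant identity matrix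 polynomial. The number $c_n$ is the minimum of $\|PF-I\|_2^2$ over $P$ of degree at most $n$, so it does not depend on the choice of minimizer. Row ball: for a $d$-tuple $X=(X_1,\dots,X_d)\in M_m(\mathbb C)^d$, $\|X\|_{row}=\|X_1X_1^*+\cdots+X_dX_d^*\|^{1/2}$ (operator norm). The row ball is $\bigsqcup_{m\ge1}\{X\in M_m(\mathbb C)^d:\|X\|_{row}<1\}$. For $F=\sum_w F_w x^w$ and $X\in M_m(\mathbb C)^d$, $F(X)=\sum_w F_w\otimes X^w\in M_k(\mathbb C)\otimes M_m(\mathbb C)$, where $X^w=X_{i_1}\cdots X_{i_m}$ for $w=i_1\cdots i_m$. $F$ is nonsingular in the row ball if $\det F(X)\ne0$ for every $X$ in the row ball (all sizes $m$). An element of $M_k(\mathbb C\langle x_1,\dots,x_d\rangle)$ is regular if it is not a zero divisor; a regular non-invertible element is an atom (is atomic) if it is not the product of two non-invertible elements of $M_k(\mathbb C\langle x_1,\dots,x_d\rangle)$. $a_n\lesssim b_n$ means there is a constant $C$ independent of $n$ (possibly depending on $F$) with $a_n\le C b_n$ for all $n\ge1$. *)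

(* Defs.v *)
Set Warnings "-notation-overridden,-ambiguous-paths,-notation-incompatible-prefix".
From mathcomp Require Import all_boot all_order all_algebra.
From mathcomp Require Import boolp classical_sets reals topology normedtype.
From mathcomp Require Import sequences exp.
From mathcomp Require Import finmap.
From mathcomp Require mxtens.
From mathcomp Require Import complex.
(* The notations of monalg clash with those of analysis. *)
From mathcomp.multinomials Require Import -(notations) monalg.

Set Implicit Arguments.
Unset Strict Implicit.
Unset Printing Implicit Defensive.

Import Order.TTheory GRing.Theory Num.Theory.
Import numFieldNormedType.Exports.

Local Open Scope ring_scope.
Local Open Scope sesquilinear_scope.

(* Matrix-valued free polynomials are kept in the form [\sum_w P_w x^w]: the
   monoid algebra, over the free monoid of words in the letters 0, ..., d-1,
   with coefficients in the (noncommutative) ring of matrices.  [mcoeff w P]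
   is the coefficient [P_w] and [msupp P] the finite set of words [w] with
   [P_w != 0]; the product multiplies coefficients and concatenates words.
   Matrices form a nontrivial ring only in positive size, hence [k.+1]. *)
Notation freepoly R d k := (malg (fmonom 'I_d) 'M[R[i]]_k.+1).

Section FreePoly.
Variables (R : realType) (d k : nat).
Local Notation poly := (freepoly R d k).
Implicit Types (F P Q G H : poly) (n m : nat).

Definition deg_le n P : Prop := forall w, w \in msupp P -> (size w <= n)%N.

(* The sum of traces is a nonnegative real number; [complex.Re] views it in
   [R]. *)
Definition norm2 P : R :=
  Num.sqrt
    (complex.Re (\sum_(w <- msupp P) \tr ((mcoeff w P)^t* *m mcoeff w P))).

(* [P] is an optimal polynomial approximant of [F^-1] of degree at most [n]. *)
Definition optimal_approximant F n P : Prop :=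
  deg_le n P /\ forall Q, deg_le n Q -> norm2 (P * F - 1) <= norm2 (Q * F - 1).

Definition l2norm m (v : 'cV[R[i]]_m) : R :=
  Num.sqrt (\sum_i ComplexField.Normc.normc (v i 0) ^+ 2).

Definition opnorm m (A : 'M[R[i]]_m) : R :=
  sup [set l2norm (A *m v) | v in [set v | l2norm v <= 1]]%classic.

Definition rownorm m (X : 'I_d -> 'M[R[i]]_m) : R :=
  Num.sqrt (opnorm (\sum_i X i *m (X i)^t*)).

Definition evalword m (X : 'I_d -> 'M[R[i]]_m) (w : fmonom 'I_d) :
  'M[R[i]]_m := \prod_(i <- w) X i.

Definition evalpoly F m (X : 'I_d -> 'M[R[i]]_m) : 'M[R[i]]_(k.+1 * m) :=
  \sum_(w <- msupp F) mxtens.tensmx (mcoeff w F) (evalword X w).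

Definition nonsingular_row_ball F : Prop :=
  forall m (X : 'I_d -> 'M[R[i]]_m),
    (0 < m)%N -> rownorm X < 1 -> \det (evalpoly F X) != 0.

Definition regular F : Prop := GRing.lreg F /\ GRing.rreg F.

Definition invertible F : Prop := exists G, F * G = 1 /\ G * F = 1.

Definition atomic F : Prop :=
  [/\ regular F, ~ invertible F &
      ~ exists G H, [/\ ~ invertible G, ~ invertible H & F = G * H]].

Definition product_of_atoms (l : nat) F : Prop :=
  exists s : seq poly,
    [/\ size s = l, (forall G, G \in s -> atomic G) & F = \prod_(G <- s) G].

End FreePoly.

(* Vinogradov's [a_n << b_n], for [n >= 1]. *)
Definition asymp_le (R : realType) (a b : nat -> R) : Prop :=
  exists C : R, forall n : nat, (1 <= n)%N -> a n <= C * b n.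

(* Main.v *)
(* Write S for the inverse power series of F.  If the homogeneous parts of S are
   bounded in norm, its Cesaro means P satisfy |P F - 1|^2 = O(1/n).  If F = F' H
   with H of this kind, and R, Q approximate the inverses of F' and H, then Q R
   approximates the inverse of F, and balancing the degrees of Q and R divides
   the exponent by 3.

   Let F be nonsingular in the row ball, of degree at most D.  For a row
   polynomial h, the coefficients of h S starting with the letter i form a series
   (A_i h) S, where A_i acts on the row polynomials of degree at most D.  The
   multiples p F in this space are stable under the A_i; let W be a minimal
   stable subspace strictly containing them.  Lifting constant terms to W with
   minimal degree gives a square G with constant term 1 such that W lies in the
   left module generated by the rows of G; hence F = H G, where H is not
   invertible.  Nonsingularity makes 1 - sum A_i (x) Y_i invertible for every
   strict row contraction Y, and a Perron-Frobenius argument on the irreducible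
   quotient of W by the multiples of F turns the A_i, after a similarity, into a
   contraction; so the homogeneous parts of the inverse of H are bounded.  If F is
   an atom then G is invertible and F inherits the bound; in general one repeats
   the argument with G, for which the space of multiples is larger.

   Conversely, evaluation at a point X of the row ball is bounded for the norm,
   so F(X) u = 0 with u <> 0 keeps |P F - 1| away from 0. *)

Require Import Defs.
From mathcomp Require Import all_boot all_order all_algebra.
From mathcomp Require Import boolp classical_sets reals topology normedtype.
From mathcomp Require Import sequences exp.
From mathcomp Require Import complex.
From mathcomp.multinomials Require Import -(notations) monalg.
From mathcomp Require Import finmap mxtens ring lra zify.
Set Implicit Arguments.
Unset Strict Implicit.
Unset Printing Implicit Defensive.
Import Order.TTheory GRing.Theory Num.Theory.
Import numFieldNormedType.Exports.
Local Open Scope ring_scope.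
Local Open Scope sesquilinear_scope.

(** * Words and matrix-valued power series *)

Section Words.
Variable d : nat.
Local Notation word := (seq 'I_d).

Fixpoint words n : seq word :=
  if n is n'.+1 then [seq i :: w | i <- enum 'I_d, w <- words n'] else [:: [::]].

Lemma mem_words n w : (w \in words n) = (size w == n).
Proof.
elim: n w => [|n IH] [|i w] //=.
  by apply/negP => /allpairsP[p []].
rewrite eqSS -IH; apply/allpairsP/idP => [[[j u]] /= [_ hu [_ ->]] //|hw].
  by exists (i, w); rewrite mem_enum.
Qed.

Lemma words_uniq n : uniq (words n).
Proof.
elim: n => //= n IH; apply: allpairs_uniq => //; first exact: enum_uniq.
by move=> [i u] [j w] _ _ /= [-> ->].
Qed.

Lemma big_words0 (V : nmodType) (f : word -> V) :
  \sum_(w <- words 0) f w = f [::].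
Proof. by rewrite big_seq1. Qed.

Lemma big_wordsS (V : nmodType) n (f : word -> V) :
  \sum_(w <- words n.+1) f w = \sum_i \sum_(w <- words n) f (i :: w).
Proof. by rewrite /= big_allpairs_dep big_enum. Qed.

Lemma eq_big_words (V : nmodType) n (f g : word -> V) :
  (forall w, size w = n -> f w = g w) ->
  \sum_(w <- words n) f w = \sum_(w <- words n) g w.
Proof. by move=> e; apply: eq_big_seq => w; rewrite mem_words => /eqP/e. Qed.

Lemma big_words_cat (V : nmodType) m n (f : word -> V) :
  \sum_(w <- words (m + n)) f w =
  \sum_(u <- words m) \sum_(v <- words n) f (u ++ v).
Proof.
elim: m f => [|m IH] f; first by rewrite big_words0.
by rewrite addSn !big_wordsS; apply: eq_bigr => i _; rewrite IH.
Qed.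

End Words.
Arguments words : simpl never.

Section Conv.
Variables (C : comNzRingType) (d : nat).
Local Notation word := (seq 'I_d).
Local Notation ser a b := (word -> 'M[C]_(a, b)).

(** Cauchy product of rectangular series: the sum of [f u *m g v] over the factorizations
    [w = u ++ v]. Peeling off the first letter replaces [f] by its left derivative
    [fun u => f (i :: u)], so identities follow by induction on the word; [convE] is the closed
    form. *)
Fixpoint conv a b c (f : ser a b) (g : ser b c) (w : word) {struct w} :
  'M[C]_(a, c) :=
  if w is i :: w' then f [::] *m g w + conv (fun u => f (i :: u)) g w'
  else f [::] *m g [::].

Definition one_ser a : ser a a := fun w => if w is [::] then 1%:M else 0.

Definition vanish_above a b n (f : ser a b) := forall w, (n < size w)%N -> f w = 0.

Lemma convE a b c (f : ser a b) (g : ser b c) w :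
  conv f g w = \sum_(j < (size w).+1) f (take j w) *m g (drop j w).
Proof.
elim: w f => [|i w IH] f /=; first by rewrite big_ord1.
by rewrite big_ord_recl /= IH.
Qed.

Lemma convDl a b c (f1 f2 : ser a b) (g : ser b c) w :
  conv (fun u => f1 u + f2 u) g w = conv f1 g w + conv f2 g w.
Proof.
by elim: w f1 f2 => [|i w IH] f1 f2 /=; rewrite ?IH mulmxDl // addrACA.
Qed.

Lemma convNl a b c (f : ser a b) (g : ser b c) w :
  conv (fun u => - f u) g w = - conv f g w.
Proof. by elim: w f => [|i w IH] f /=; rewrite ?IH mulNmx // opprD. Qed.

Lemma convBl a b c (f1 f2 : ser a b) (g : ser b c) w :
  conv (fun u => f1 u - f2 u) g w = conv f1 g w - conv f2 g w.
Proof. by rewrite convDl convNl. Qed.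

Lemma convBr a b c (f : ser a b) (g1 g2 : ser b c) w :
  conv f (fun u => g1 u - g2 u) w = conv f g1 w - conv f g2 w.
Proof. by rewrite !convE -sumrB; apply: eq_bigr => j _; rewrite mulmxBr. Qed.

Lemma convMl a0 a b c (M : 'M[C]_(a0, a)) (f : ser a b) (g : ser b c) w :
  conv (fun u => M *m f u) g w = M *m conv f g w.
Proof. by elim: w f => [|i w IH] f /=; rewrite ?IH ?mulmxDr mulmxA. Qed.

Lemma conv0l a b c (f : ser a b) (g : ser b c) w :
  (forall u, f u = 0) -> conv f g w = 0.
Proof.
by move=> e; rewrite convE big1 // => j _; rewrite e mul0mx.
Qed.

Lemma conv1l a b (f : ser a b) w : conv (one_ser a) f w = f w.
Proof.
case: w => [|i w] /=; rewrite mul1mx // conv0l ?addr0 //.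
Qed.

Lemma eq_conv a b c (f f' : ser a b) (g g' : ser b c) w :
  (forall u, f u = f' u) -> (forall u, g u = g' u) ->
  conv f g w = conv f' g' w.
Proof.
by move=> ef eg; rewrite !convE; apply: eq_bigr => j _; rewrite ef eg.
Qed.

Lemma convA a b c e (f : ser a b) (g : ser b c) (h : ser c e) w :
  conv (conv f g) h w = conv f (conv g h) w.
Proof.
elim: w f => [|i w IH] f /=; first by rewrite mulmxA.
by rewrite convDl convMl IH mulmxDr !mulmxA addrA.
Qed.

Lemma vanish_conv a b c m n (f : ser a b) (g : ser b c) :
  vanish_above m f -> vanish_above n g -> vanish_above (m + n) (conv f g).
Proof.
move=> hf hg w hw; rewrite convE big1 // => j _.
have [hj|hj] := ltnP m (size (take j w)); first by rewrite hf ?mul0mx.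
rewrite hg ?mulmx0 //; move: hj; rewrite size_take size_drop.
case: ltnP => hjw; lia.
Qed.

End Conv.
Arguments one_ser {C d}.

(** * The Frobenius norm *)

Lemma big_mxtens (V : nmodType) m n (F : 'I_(m * n) -> V) :
  \sum_k F k = \sum_i \sum_j F (mxtens_index (i, j)).
Proof.
rewrite pair_big /=; apply: reindex; exists (@mxtens_unindex m n) => k _.
  by case: k => i j; rewrite mxtens_indexK.
by rewrite -[in RHS](mxtens_unindexK k); case: (mxtens_unindex k).
Qed.

Section Frobenius.
Variable R : realType.
Local Notation C := R[i].
Local Notation Re := (@complex.Re R).
Local Notation Im := (@complex.Im R).

(** The squared modulus, taken in [R] so that estimates live in a totally ordered field and involve
    no square roots. *)
Definition sqn (z : C) : R := Re z ^+ 2 + Im z ^+ 2.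

Lemma normc_sq (z : C) : ComplexField.Normc.normc z ^+ 2 = sqn z.
Proof. by case: z => a b; rewrite sqr_sqrtr // addr_ge0 ?sqr_ge0. Qed.

Lemma sqnE (z : C) : (sqn z)%:C%C = z * z^*.
Proof. by rewrite -normCK -add_Re2_Im2. Qed.

Lemma sqn_ge0 z : 0 <= sqn z.
Proof. by rewrite addr_ge0 ?sqr_ge0. Qed.

Lemma sqn_eq0 z : (sqn z == 0) = (z == 0).
Proof.
case: z => a b; rewrite /sqn /= paddr_eq0 ?sqr_ge0 // !sqrf_eq0.
by rewrite eq_complex.
Qed.

Lemma sqn0 : sqn 0 = 0. Proof. by apply/eqP; rewrite sqn_eq0. Qed.

Lemma sqnM x y : sqn (x * y) = sqn x * sqn y.
Proof. by case: x y => [a b] [e f]; rewrite /sqn /=; ring. Qed.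

Lemma sqnR (a : R) : sqn a%:C%C = a ^+ 2.
Proof. by rewrite /sqn /= expr0n addr0. Qed.

Lemma sqnN x : sqn (- x) = sqn x.
Proof. by case: x => a b; rewrite /sqn /= !sqrrN. Qed.

Lemma sqnJ x : sqn x^* = sqn x.
Proof. by case: x => a b; rewrite /sqn /= sqrrN. Qed.

Lemma sqnD2 x y : sqn (x + y) <= 2 * sqn x + 2 * sqn y.
Proof. by case: x y => [a b] [e f]; rewrite /sqn /=; have := sqr_ge0 (a - e);
have := sqr_ge0 (b - f); nra. Qed.

(** Cauchy-Schwarz without conjugation, by induction on [s]. With [a], [b] the new terms and [A],
    [B] the old sums, the cross term is at most [2 sqrt(a b A B) <= a B + b A]. *)
Lemma sqn_dot (T : Type) (s : seq T) (x y : T -> C) :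
  sqn (\sum_(j <- s) x j * y j) <=
  (\sum_(j <- s) sqn (x j)) * \sum_(j <- s) sqn (y j).
Proof.
elim: s => [|j s]; first by rewrite !big_nil sqn0 mulr0.
rewrite !big_cons.
set z := \sum_(j <- s) _; set A := \sum_(j <- s) _; set B := \sum_(j <- s) _.
have A0 : 0 <= A by apply: sumr_ge0 => *; apply: sqn_ge0.
have B0 : 0 <= B by apply: sumr_ge0 => *; apply: sqn_ge0.
have [a0 b0] := (sqn_ge0 (x j), sqn_ge0 (y j)).
have euv : sqn (x j * y j) = sqn (x j) * sqn (y j) by rewrite sqnM.
move: (sqn (x j)) (sqn (y j)) a0 b0 euv => a b a0 b0.
case: (x j * y j) z => [u v] [p q]; rewrite /sqn /= => euv h.
have cross : 2 * (u * p + v * q) <= a * B + b * A.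
  apply: le_trans (ler_norm _) _.
  rewrite -(@ler_pXn2r _ 2) ?nnegrE //; last by rewrite addr_ge0 ?mulr_ge0.
  rewrite real_normK ?num_real //.
  have h1 : (2 * (u * p + v * q)) ^+ 2 <= 4 * ((u ^+ 2 + v ^+ 2) * (p ^+ 2 + q ^+ 2)).
    have := sqr_ge0 (u * q - v * p); nra.
  apply: le_trans h1 _; rewrite euv.
  have h2 : a * b * (p ^+ 2 + q ^+ 2) <= a * b * (A * B).
    by rewrite ler_wpM2l // mulr_ge0.
  have := sqr_ge0 (a * B - b * A); nra.
nra.
Qed.

(** The squared Frobenius norm. *)
Definition nf m n (M : 'M[C]_(m, n)) : R := \sum_i \sum_j sqn (M i j).

Lemma nf_ge0 m n (M : 'M[C]_(m, n)) : 0 <= nf M.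
Proof. by apply: sumr_ge0 => i _; apply: sumr_ge0 => j _; apply: sqn_ge0. Qed.

Lemma nf0 m n : nf (0 : 'M[C]_(m, n)) = 0.
Proof. by rewrite /nf big1 // => i _; rewrite big1 // => j _; rewrite mxE sqn0. Qed.

Lemma nf_eq0 m n (M : 'M[C]_(m, n)) : (nf M == 0) = (M == 0).
Proof.
apply/eqP/eqP => [|->]; last exact: nf0.
move=> /eqP; rewrite psumr_eq0; last first.
  by move=> i _; apply: sumr_ge0 => j _; apply: sqn_ge0.
move=> /allP h; apply/matrixP => i j; rewrite mxE.
have := h i; rewrite mem_index_enum => /(_ isT) /=.
rewrite psumr_eq0; last by move=> k _; apply: sqn_ge0.
by move=> /allP /(_ j); rewrite mem_index_enum => /(_ isT) /=; rewrite sqn_eq0 => /eqP.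
Qed.

Lemma nfN m n (M : 'M[C]_(m, n)) : nf (- M) = nf M.
Proof. by apply: eq_bigr => i _; apply: eq_bigr => j _; rewrite mxE sqnN. Qed.

Lemma nfZ m n (a : C) (M : 'M[C]_(m, n)) : nf (a *: M) = sqn a * nf M.
Proof.
rewrite /nf mulr_sumr; apply: eq_bigr => i _; rewrite mulr_sumr.
by apply: eq_bigr => j _; rewrite mxE sqnM.
Qed.

Lemma nfJ m n (M : 'M[C]_(m, n)) : nf (map_mx Num.conj M) = nf M.
Proof. by apply: eq_bigr => i _; apply: eq_bigr => j _; rewrite mxE sqnJ. Qed.

Lemma nf_tr m n (M : 'M[C]_(m, n)) : nf M^T = nf M.
Proof.
by rewrite /nf exchange_big; apply: eq_bigr => i _; apply: eq_bigr => j _; rewrite mxE.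
Qed.

Lemma nfE m n (M : 'M[C]_(m, n)) : (nf M)%:C%C = \tr (M *m M ^t*).
Proof.
rewrite /nf /mxtrace rmorph_sum; apply: eq_bigr => i _.
rewrite rmorph_sum mxE; apply: eq_bigr => j _.
by rewrite /= sqnE !mxE.
Qed.

Lemma nfD2 m n (A B : 'M[C]_(m, n)) : nf (A + B) <= 2 * nf A + 2 * nf B.
Proof.
rewrite /nf !mulr_sumr -big_split; apply: ler_sum => i _.
rewrite !mulr_sumr -big_split; apply: ler_sum => j _.
by rewrite mxE sqnD2.
Qed.

Lemma nfM m n p (A : 'M[C]_(m, n)) (B : 'M[C]_(n, p)) :
  nf (A *m B) <= nf A * nf B.
Proof.
rewrite -(nf_tr B) /nf mulr_suml; apply: ler_sum => i _.
rewrite mulr_sumr; apply: ler_sum => j _; rewrite mxE.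
apply: le_trans (sqn_dot _ _ _) _; rewrite ler_wpM2l //.
  by apply: sumr_ge0 => k _; apply: sqn_ge0.
by under [leRHS]eq_bigr do rewrite mxE.
Qed.

Lemma nf_rows a b (V : 'M[C]_(a, b)) : nf V = \sum_k nf (row k V).
Proof.
rewrite /nf; apply: eq_bigr => k _; rewrite big_ord1.
by apply: eq_bigr => j _; rewrite mxE.
Qed.

(** Entrywise Cauchy-Schwarz. For indicator weights the loss is only the number of nonzero
    weights. *)
Lemma nf_sum (T : Type) (s : seq T) m n (a : T -> R) (M : T -> 'M[C]_(m, n)) :
  nf (\sum_(j <- s) (a j)%:C%C *: M j) <=
  (\sum_(j <- s) a j ^+ 2) * \sum_(j <- s) nf (M j).
Proof.
rewrite /nf [X in _ * X]exchange_big /= mulr_sumr; apply: ler_sum => i _.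
rewrite [X in _ * X]exchange_big /= mulr_sumr; apply: ler_sum => j _.
rewrite summxE; under [X in sqn X]eq_bigr do rewrite mxE.
apply: le_trans (sqn_dot _ _ _) _.
by rewrite (eq_bigr _ (fun k _ => sqnR (a k))).
Qed.

Lemma nf_tens_sum (T : Type) (s : seq T) m n p q
    (A : T -> 'M[C]_(m, n)) (B : T -> 'M[C]_(p, q)) :
  nf (\sum_(j <- s) tensmx (A j) (B j)) <=
  (\sum_(j <- s) nf (A j)) * \sum_(j <- s) nf (B j).
Proof.
rewrite {1}/nf big_mxtens.
under eq_bigr do under eq_bigr do rewrite big_mxtens.
rewrite /nf [X in X * _]exchange_big /= mulr_suml; apply: ler_sum => i _.
rewrite [X in _ * X]exchange_big /= mulr_sumr; apply: ler_sum => k _.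
rewrite [X in X * _]exchange_big /= mulr_suml; apply: ler_sum => j _.
rewrite [X in _ * X]exchange_big /= mulr_sumr; apply: ler_sum => l _.
rewrite summxE; under [X in sqn X]eq_bigr do rewrite tensmxE.
exact: sqn_dot.
Qed.

End Frobenius.

(** * Homogeneous parts and Cesaro means *)

Section Levels.
Variables (R : realType) (d : nat).
Local Notation C := R[i].
Local Notation word := (seq 'I_d).
Local Notation ser a b := (word -> 'M[C]_(a, b)).

(** The squared norm of the homogeneous part of degree [n]. The companion [tot n] adds the degrees
    strictly below [n], which makes sense for series that are not square summable. *)
Definition lev a b n (f : ser a b) : R := \sum_(w <- words d n) nf (f w).

Definition tot a b n (f : ser a b) : R := \sum_(m < n) lev m f.

Lemma lev_ge0 a b n (f : ser a b) : 0 <= lev n f.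
Proof. by apply: sumr_ge0 => w _; apply: nf_ge0. Qed.

Lemma eq_lev a b n (f g : ser a b) :
  (forall w, size w = n -> f w = g w) -> lev n f = lev n g.
Proof. by move=> e; apply: eq_big_words => w /e ->. Qed.

Lemma lev_vanish a b n m (f : ser a b) :
  vanish_above n f -> (n < m)%N -> lev m f = 0.
Proof.
move=> hf hm; rewrite /lev big_seq big1 // => w; rewrite mem_words => /eqP hw.
by rewrite hf ?hw // nf0.
Qed.

Lemma tot_ge0 a b n (f : ser a b) : 0 <= tot n f.
Proof. by apply: sumr_ge0 => w _; apply: lev_ge0. Qed.

Lemma eq_tot a b n (f g : ser a b) : (forall w, f w = g w) -> tot n f = tot n g.
Proof. by move=> e; apply: eq_bigr => m _; apply: eq_lev => w _; apply: e. Qed.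

Lemma tot_vanish a b n M (f : ser a b) :
  vanish_above n f -> tot M f <= tot n.+1 f.
Proof.
move=> hf; have [hM|hM] := leqP M n.+1.
  rewrite -(subnKC hM) /tot big_split_ord /= lerDl.
  by apply: sumr_ge0 => i _; apply: lev_ge0.
rewrite -(subnKC (ltnW hM)) /tot big_split_ord /= [X in _ + X]big1 ?addr0 // => i _.
by rewrite (lev_vanish hf) // ltn_addr.
Qed.

Lemma tot_bound a b n M (f : ser a b) (c : R) : 0 <= c ->
  (forall m, lev m f <= c) -> (forall m, (n < m)%N -> lev m f = 0) ->
  tot M f <= n.+1%:R * c.
Proof.
move=> c0 hc h0.
suff : tot M f <= (minn M n.+1)%:R * c.
  by move=> h; apply: le_trans h _; rewrite ler_wpM2r // ler_nat geq_minr.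
elim: M => [|M IH]; first by rewrite /tot big_ord0 min0n mul0r.
rewrite /tot big_ord_recr /= -/(tot M f).
have [hM|hM] := leqP M n.
  have -> : minn M.+1 n.+1 = (minn M n.+1).+1 by lia.
  by rewrite -natr1 mulrDl mul1r lerD.
rewrite h0 // addr0; apply: le_trans IH _.
by rewrite ler_wpM2r // ler_nat; lia.
Qed.

Lemma tot_D2 a b n (f g : ser a b) :
  tot n (fun w => f w + g w) <= 2 * tot n f + 2 * tot n g.
Proof.
rewrite /tot !mulr_sumr -big_split; apply: ler_sum => m _.
rewrite /lev !mulr_sumr -big_split; apply: ler_sum => w _; exact: nfD2.
Qed.

(** For a fixed cut [j], a word of length [m] is a pair of words of lengths [j] and [m - j], so the
    sum factors after [nfM]. *)
Lemma lev_split a b c j m (f : ser a b) (g : ser b c) : (j <= m)%N ->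
  lev m (fun w => f (take j w) *m g (drop j w)) <= lev j f * lev (m - j) g.
Proof.
move=> hj; rewrite {1}/lev -{1}(subnKC hj) big_words_cat /lev mulr_suml.
rewrite big_seq [leRHS]big_seq.
apply: ler_sum => u; rewrite mem_words => /eqP hu; rewrite mulr_sumr.
by apply: ler_sum => v _; rewrite -hu take_size_cat // drop_size_cat // nfM.
Qed.

Lemma lev_wconv a b c m (x : nat -> R) (f : ser a b) (g : ser b c) :
  lev m (fun w => \sum_(j < m.+1) (x j)%:C%C *: (f (take j w) *m g (drop j w)))
  <= (\sum_(j < m.+1) x j ^+ 2) * \sum_(j < m.+1) lev j f * lev (m - j) g.
Proof.
apply: (@le_trans _ _ ((\sum_(j < m.+1) x j ^+ 2) * \sum_(j < m.+1)
   lev m (fun w => f (take j w) *m g (drop j w)))); last first.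
  rewrite ler_wpM2l //; first by apply: sumr_ge0 => *; apply: sqr_ge0.
  by apply: ler_sum => j _; apply: lev_split; rewrite -ltnS.
rewrite /lev [X in _ * X]exchange_big /= mulr_sumr; apply: ler_sum => w _.
exact: nf_sum.
Qed.

Lemma sum_indic n m : \sum_(j < m) ((j <= n)%N%:R : R) ^+ 2 <= n.+1%:R.
Proof.
have -> : \sum_(j < m) ((j <= n)%N%:R : R) ^+ 2 = (minn m n.+1)%:R.
  elim: m => [|m IH]; first by rewrite big_ord0 min0n.
  rewrite big_ord_recr /= IH; have [hm|hm] := leqP m n.
    by rewrite expr1n natr1; congr _%:R; lia.
  by rewrite expr0n addr0; congr _%:R; lia.
by rewrite ler_nat geq_minr.
Qed.

(** Only the cuts [j <= n] contribute. Indicator weights in [lev_wconv] make the loss [n.+1],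
    independent of [m]. *)
Lemma lev_conv_l a b c n m (f : ser a b) (g : ser b c) : vanish_above n f ->
  lev m (conv f g) <= n.+1%:R * \sum_(j < m.+1) lev j f * lev (m - j) g.
Proof.
move=> hf.
rewrite (@eq_lev _ _ _ _ (fun w => \sum_(j < m.+1) ((j <= n)%N%:R : R)%:C%C *:
    (f (take j w) *m g (drop j w)))); last first.
  move=> w hw; rewrite convE hw; apply: eq_bigr => j _.
  case: (leqP j n) => hj; first by rewrite scale1r.
  by rewrite hf ?mul0mx ?scaler0 // size_takel // hw -ltnS.
apply: le_trans (lev_wconv m (fun j => (j <= n)%N%:R) f g) _; rewrite ler_wpM2r ?sum_indic //.
by apply: sumr_ge0 => j _; rewrite mulr_ge0 ?lev_ge0.
Qed.

Lemma sum_indic_rev n m (e : R) (x : nat -> R) : 0 <= e ->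
  (forall j, (j <= m)%N -> `|x j| <= (m - j <= n)%N%:R * e) ->
  \sum_(j < m.+1) x j ^+ 2 <= n.+1%:R * e ^+ 2.
Proof.
move=> e0 hx; apply: (@le_trans _ _ (\sum_(j < m.+1)
    ((m - j <= n)%N%:R : R) ^+ 2 * e ^+ 2)).
  apply: ler_sum => j _; rewrite -exprMn -[x j ^+ 2]real_normK ?num_real //.
  by rewrite ler_sqr ?nnegrE ?mulr_ge0 ?hx // -ltnS.
rewrite -mulr_suml ler_wpM2r ?sqr_ge0 //.
rewrite (reindex_inj rev_ord_inj) /=.
apply: le_trans (sum_indic n m.+1); rewrite le_eqVlt; apply/orP; left.
by apply/eqP; apply: eq_bigr => j _; rewrite subSS subKn // -ltnS.
Qed.

Lemma lev_conv_r a b c n m (f : ser a b) (g : ser b c) : vanish_above n g ->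
  lev m (conv f g) <= n.+1%:R * \sum_(j < m.+1) lev j f * lev (m - j) g.
Proof.
move=> hg.
rewrite (@eq_lev _ _ _ _ (fun w => \sum_(j < m.+1) ((m - j <= n)%N%:R : R)%:C%C *:
    (f (take j w) *m g (drop j w)))); last first.
  move=> w hw; rewrite convE hw; apply: eq_bigr => j _.
  case: (leqP (m - j) n) => hj; first by rewrite scale1r.
  by rewrite hg ?mulmx0 ?scaler0 // size_drop hw.
apply: le_trans (lev_wconv m (fun j => (m - j <= n)%N%:R) f g) _; rewrite ler_wpM2r //.
  by apply: sumr_ge0 => j _; rewrite mulr_ge0 ?lev_ge0.
have := @sum_indic_rev n m 1 (fun j => (m - j <= n)%N%:R) ler01.
rewrite expr1n mulr1; apply=> j _.
by rewrite mulr1 ger0_norm.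
Qed.

Lemma sum_cauchy M (x y : nat -> R) :
  (forall n, 0 <= x n) -> (forall n, 0 <= y n) ->
  \sum_(m < M) \sum_(j < m.+1) x j * y (m - j)%N <=
  (\sum_(j < M) x j) * \sum_(j < M) y j.
Proof.
move=> x0 y0; elim: M x x0 => [|M IH] x x0; first by rewrite !big_ord0 mulr0.
under eq_bigr do rewrite big_ord_recl /=.
rewrite big_split /= -mulr_sumr [X in _ <= X * _]big_ord_recl /= mulrDl.
under eq_bigr do rewrite subn0.
rewrite lerD2l big_ord_recl /= big_ord0 add0r.
apply: le_trans (IH (fun j => x j.+1) (fun n => x0 n.+1)) _.
rewrite ler_wpM2l ?sumr_ge0 // big_ord_recr /= lerDl //.
Qed.

Lemma tot_conv_l a b c n M (f : ser a b) (g : ser b c) : vanish_above n f ->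
  tot M (conv f g) <= n.+1%:R * (tot M f * tot M g).
Proof.
move=> hf; apply: (@le_trans _ _ (n.+1%:R *
    \sum_(m < M) \sum_(j < m.+1) lev j f * lev (m - j) g)).
  by rewrite mulr_sumr; apply: ler_sum => m _; apply: lev_conv_l.
rewrite ler_wpM2l //.
exact: (sum_cauchy M (fun j => lev_ge0 j f) (fun j => lev_ge0 j g)).
Qed.

Lemma tot_conv_r a b c n M (f : ser a b) (g : ser b c) : vanish_above n g ->
  tot M (conv f g) <= n.+1%:R * (tot M f * tot M g).
Proof.
move=> hg; apply: (@le_trans _ _ (n.+1%:R *
    \sum_(m < M) \sum_(j < m.+1) lev j f * lev (m - j) g)).
  by rewrite mulr_sumr; apply: ler_sum => m _; apply: lev_conv_r.
rewrite ler_wpM2l //.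
exact: (sum_cauchy M (fun j => lev_ge0 j f) (fun j => lev_ge0 j g)).
Qed.

(** [S] is a formal left inverse with bounded homogeneous parts; its total norm may be infinite, as
    for [1 - x]. *)
Definition bounded_inverse a (f : ser a a) := exists (S : ser a a) (c : R),
  (forall w, conv S f w = one_ser a w) /\ (forall n, lev n S <= c).

Section Cesaro.
Variables (a D : nat) (f : ser a a).
Hypothesis hf : vanish_above D f.

(* [Q] is the Cesaro mean of the inverse [S].  The weights in the coefficient of
   [Q f] at a given word differ by at most [D / (n + 1)]; if they were equal, that
   coefficient would vanish, since [S f = 1]. *)
Lemma bounded_inverse_approx : bounded_inverse f ->
  exists c : R, 0 <= c /\ forall n, exists Q : ser a a,
    [/\ vanish_above n Q, forall m, lev m Q <= c
      & forall M, tot M (fun w => conv Q f w - one_ser a w) <= c / n.+1%:R].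
Proof.
case=> S [c [hS hc]].
have c0 : 0 <= c by apply: le_trans (hc 0%N); apply: lev_ge0.
set L := tot D.+1 f.
have L0 : 0 <= L by apply: tot_ge0.
set e := D%:R : R.
set b := D.+1%:R * e ^+ 2 * (c * L).
have b0 : 0 <= b by rewrite !mulr_ge0 ?sqr_ge0.
have db0 : 0 <= D.+1%:R * b by rewrite mulr_ge0.
exists (c + D.+1%:R * b); split; first by rewrite addr_ge0.
(* The truncated subtraction makes the weight vanish for [j > n], which bounds the degree of the
   mean. *)
move=> n; pose l j : R := (n.+1 - j)%N%:R / n.+1%:R.
have n0 : 0 < n.+1%:R :> R by rewrite ltr0n.
have l0 j : 0 <= l j by rewrite divr_ge0.
have l1 j : l j <= 1 by rewrite ler_pdivrMr // mul1r ler_nat leq_subr.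
exists (fun w => (l (size w))%:C%C *: S w); split.
- by move=> w hw; rewrite /l (eqP (_ : n.+1 - size w == 0)%N) ?mul0r ?scale0r // subn_eq0.
- move=> m; apply: (@le_trans _ _ (lev m S)).
    by apply: ler_sum => w _; rewrite nfZ sqnR ler_piMl ?nf_ge0 ?expr_le1.
  by apply: le_trans (hc m) _; rewrite lerDl.
move=> M.
pose g w := conv (fun w0 => (l (size w0))%:C%C *: S w0) f w - one_ser a w.
(* Where [m - j > D] the coefficient of [f] vanishes, so the weight may be set to zero; elsewhere it
   is at most [D / n.+1] in absolute value. *)
pose x m j : R := if (m - j <= D)%N then l j - l m else 0.
have eg m w : size w = m ->
    g w = \sum_(j < m.+1) (x m j)%:C%C *: (S (take j w) *m f (drop j w)).
  move=> hw; rewrite /g.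
  have -> : one_ser a w = (l m)%:C%C *: conv S f w.
    rewrite hS; case: (w) hw => [|i u] <- /=; last by rewrite scaler0.
    by rewrite /l subn0 divff ?gt_eqF // scale1r.
  rewrite !convE hw scaler_sumr -sumrB; apply: eq_bigr => j _.
  have hj : (j <= m)%N by rewrite -ltnS.
  rewrite size_takel ?hw // -scalemxAl -scalerBl -rmorphB /= /x.
  case: leqP => // hD; rewrite hf ?mulmx0 ?scaler0 //.
  by rewrite size_drop hw.
have xb m j : (j <= m)%N -> `|x m j| <= (m - j <= D)%N%:R * (e / n.+1%:R).
  move=> hj; rewrite /x; case: leqP => hD; last by rewrite normr0 mul0r.
  rewrite mul1r /l -mulrBl normrM (ger0_norm (_ : 0 <= n.+1%:R^-1)) ?invr_ge0 //.
  rewrite ler_pM2r ?invr_gt0 // -natrB ?ger0_norm ?ler_nat //; lia.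
(* Each level of the error is O(1/n^2), and at most [n + D + 1] levels are nonzero, hence O(1/n) in
   all. *)
have hlev m : lev m g <= b / n.+1%:R ^+ 2.
  rewrite (@eq_lev _ _ _ _ _ (fun w hw => eg m w hw)).
  apply: le_trans (lev_wconv m (x m) S f) _.
  have -> : b / n.+1%:R ^+ 2 = D.+1%:R * (e / n.+1%:R) ^+ 2 * (c * L).
    by rewrite /b expr_div_n; field; rewrite addrC natr1 gt_eqF.
  apply: ler_pM.
  - by apply: sumr_ge0 => *; apply: sqr_ge0.
  - by apply: sumr_ge0 => *; rewrite mulr_ge0 ?lev_ge0.
  - by apply: sum_indic_rev; rewrite ?divr_ge0 //; apply: xb.
  apply: (@le_trans _ _ (\sum_(j < m.+1) c * lev (m - j) f)).
    by apply: ler_sum => j _; rewrite ler_wpM2r ?lev_ge0.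
  rewrite -mulr_sumr ler_wpM2l // (reindex_inj rev_ord_inj) /=.
  apply: le_trans (tot_vanish m.+1 hf).
  rewrite le_eqVlt; apply/orP; left; apply/eqP; apply: eq_bigr => j _.
  by rewrite subSS subKn // -ltnS.
have hlev0 m : (n + D < m)%N -> lev m g = 0.
  move=> hm; rewrite /lev big_seq big1 // => w; rewrite mem_words => /eqP hw.
  rewrite (eg _ _ hw) big1 ?nf0 // => j _; rewrite /x.
  case: leqP => hD; last by rewrite scale0r.
  have hj : (j <= m)%N by rewrite -ltnS.
  have [e1 e2] : (n.+1 - j = 0 /\ n.+1 - m = 0)%N by lia.
  by rewrite /l e1 e2 subrr scale0r.
apply: le_trans (tot_bound _ _ hlev hlev0) _; first by rewrite divr_ge0 ?sqr_ge0.
rewrite -subr_ge0.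
have -> : (c + D.+1%:R * b) / n.+1%:R - (n + D).+1%:R * (b / n.+1%:R ^+ 2) =
    c / n.+1%:R + n%:R * D%:R * b / n.+1%:R ^+ 2.
  rewrite -addSn natrD -!natr1; field; rewrite natr1 gt_eqF //.
by rewrite addr_ge0 ?divr_ge0 ?mulr_ge0 ?sqr_ge0.
Qed.

End Cesaro.
End Levels.

(** * Rates for products *)

Lemma leq_double_half n : (n <= (n./2).*2.+1)%N.
Proof. by rewrite -{1}(odd_double_half n) -add1n leq_add2r leq_b1. Qed.

Section Rate.
Variables (R : realType) (d : nat).
Local Notation C := R[i].
Local Notation word := (seq 'I_d).
Local Notation ser a b := (word -> 'M[C]_(a, b)).

(** The bound holds for all truncations [M], hence for the full squared norm; [n.+1] keeps the
    denominator positive at [n = 0]. *)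
Definition approx_rate a (f : ser a a) (p : R) := exists c : R, 0 <= c /\
  forall n, exists Q : ser a a, vanish_above n Q /\
    forall M, tot M (fun w => conv Q f w - one_ser a w) <= c / (n.+1%:R `^ p).

Lemma bounded_inverse_rate a D (f : ser a a) :
  vanish_above D f -> bounded_inverse f -> approx_rate f 1.
Proof.
move=> hf /(bounded_inverse_approx hf)[c [c0 h]]; exists c; split=> // n.
have [Q [hQ _ hM]] := h n; exists Q; split=> // M.
by rewrite powRr1.
Qed.

(* [P = Q R] with [R] approximating the inverse of [f] and [Q] that of [g];
   since left multiplication by [Q] costs a factor [(deg Q)^2], the best choice
   is [deg Q ~ (deg R)^(p/3)]. *)
Lemma approx_rate_mul a D (f g : ser a a) (p : R) : 0 < p -> p <= 1 ->
  vanish_above D g -> approx_rate f p -> bounded_inverse g ->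
  approx_rate (conv f g) (p / 3).
Proof.
move=> p0 p1 hg [c2 [c20 hf]] /(bounded_inverse_approx hg)[c1 [c10 hg1]].
set L := tot D.+1 g.
have L0 : 0 <= L by apply: tot_ge0.
have p30 : 0 < p / 3 by rewrite divr_gt0.
pose A := 2 * (D.+1%:R * L * c1 * c2) + 4 * c1.
have A0 : 0 <= A by rewrite addr_ge0 ?mulr_ge0.
exists (2 * A); split; first by rewrite mulr_ge0.
(* [P], of degree at most [m], approximates the inverse of [f]. For [g] the degree is [n], where
   [n + 1] is the integer part of [x]; then [n <= m] and the total degree is at most [N]. *)
move=> N; pose m := (N./2)%N.
pose x : R := m.+1%:R `^ (p / 3).
have m0 : (0 : R) < m.+1%:R by rewrite ltr0n.
have x1 : 1 <= x.
  by rewrite -(powRr0 m.+1%:R) ler_powR ?ler1n ?ltW.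
have xm : x <= m.+1%:R.
  rewrite -[leRHS](powRr1 (ltW m0)) ler_powR ?ler1n //; lra.
have x0 : 0 < x by apply: lt_le_trans x1.
have /andP[ht1 ht2] : (Num.truncn x)%:R <= x < (Num.truncn x).+1%:R.
  by rewrite truncn_itv // ltW.
have ht0 : (0 < Num.truncn x)%N.
  by rewrite -ltnS -(ltr_nat R); apply: le_lt_trans ht2.
move: ht1 ht2; case: (Num.truncn x) ht0 => // n _ ht1 ht2.
have nm : (n <= m)%N by rewrite -ltnS -(ler_nat R); apply: le_trans xm.
have [P [hP hPM]] := hf m.
have [Q [hQ hQl hQM]] := hg1 n.
exists (conv Q P); split.
  move=> w hw; apply: (vanish_conv hQ hP); apply: leq_ltn_trans hw.
  apply: leq_trans (leq_add nm (leqnn m)) _.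
  by rewrite addnn -[leqRHS](odd_double_half N) leq_addl.
move=> M.
pose X w := conv P f w - one_ser a w.
(* The error splits as [Q (P f - 1) g + (Q g - 1)]. *)
have -> : tot M (fun w => conv (conv Q P) (conv f g) w - one_ser a w) =
    tot M (fun w => conv (conv Q X) g w + (conv Q g w - one_ser a w)).
  apply: eq_tot => w; rewrite addrA; congr (_ - _).
  rewrite (convA Q X) /X.
  have -> : conv Q (conv (fun w0 => conv P f w0 - one_ser a w0) g) w =
     conv Q (conv (conv P f) g) w - conv Q g w.
    rewrite -convBr; apply: eq_conv => // u; rewrite convBl.
    by rewrite conv1l.
  rewrite subrK convA; apply: eq_conv => // u; by rewrite convA.
apply: le_trans (tot_D2 _ _ _) _.
have b1 : tot M (conv (conv Q X) g) <=
    D.+1%:R * L * c1 * c2 * (n.+1%:R ^+ 2 / m.+1%:R `^ p).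
  apply: le_trans (tot_conv_r _ _ hg) _.
  have hL : tot M g <= L by apply: tot_vanish.
  have hX : tot M (conv Q X) <= n.+1%:R * (n.+1%:R * c1 * (c2 / m.+1%:R `^ p)).
    apply: le_trans (tot_conv_l _ _ hQ) _; rewrite ler_wpM2l //.
    apply: ler_pM; rewrite ?tot_ge0 //.
    by apply: tot_bound => // j hj; apply: lev_vanish hj.
  apply: (@le_trans _ _ (D.+1%:R * (n.+1%:R * (n.+1%:R * c1 * (c2 / m.+1%:R `^ p)) * L))).
    by rewrite ler_wpM2l // ler_pM ?tot_ge0.
  rewrite le_eqVlt; apply/orP; left; apply/eqP; ring.
have e3 : m.+1%:R `^ p = x ^+ 3.
  by rewrite -powR_mulrn ?ltW // /x -powRrM divfK // pnatr_eq0.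
(* Since [n + 1 <= x] and [(m + 1)^p = x^3], the quotient is at most [x^2 / x^3]. *)
have b2 : n.+1%:R ^+ 2 / m.+1%:R `^ p <= x^-1.
  rewrite e3 ler_pdivrMr ?exprn_gt0 // exprS mulKf ?gt_eqF //.
  by rewrite ler_sqr // nnegrE ltW.
have b3 : n.+1%:R^-1 <= 2 * x^-1 :> R.
  rewrite -[leLHS]mul1r ler_pdivrMr ?ltr0n // mulrAC ler_pdivlMr // mul1r.
  by apply: le_trans (ltW ht2) _; rewrite -natrM ler_nat mul2n doubleS !ltnS -addnn leq_addl.
(* This follows from [N + 1 <= 2 (m + 1)] and [2^(p/3) <= 2]. *)
have b4 : x^-1 <= 2 / N.+1%:R `^ (p / 3).
  rewrite ler_pdivlMr ?powR_gt0 // mulrC ler_pdivrMr //.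
  apply: (@le_trans _ _ ((2 * m.+1%:R) `^ (p / 3))).
    apply: ge0_ler_powR; rewrite ?nnegrE ?(ltW p30) ?mulr_ge0 //.
    by rewrite -natrM ler_nat mul2n doubleS ltnS leq_double_half.
  rewrite powRM // ler_wpM2r ?(ltW x0) //.
  rewrite -[leRHS](powRr1 (ltW (ltr0Sn R 1))) ler_powR ?ler1n //; lra.
apply: (@le_trans _ _ (A * x^-1)); last first.
  by rewrite (mulrC 2) -mulrA ler_wpM2l.
rewrite /A [leRHS]mulrDl; apply: lerD.
  rewrite -mulrA ler_wpM2l //; apply: le_trans b1 _.
  by rewrite ler_wpM2l // !mulr_ge0.
have := hQM M; have -> : 4 * c1 * x^-1 = 2 * (c1 * (2 * x^-1)) by ring.
move=> h; rewrite ler_wpM2l //; apply: le_trans h _.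
by rewrite ler_wpM2l.
Qed.

End Rate.

(** * Compactness and positive semidefinite matrices *)

(** The cube [[-1, 1]^m] is compact, and a cluster point of the sequence is approached at
    arbitrarily large indices. *)
Lemma bolzano_weierstrass (R : realType) m (u : nat -> 'rV[R]_m) :
  (forall n j, `|u n 0 j| <= 1) ->
  exists l : 'rV[R]_m, forall e, 0 < e -> forall N : nat,
    exists n, (N <= n)%N /\ forall j, `|u n 0 j - l 0 j| < e.
Proof.
move=> hu.
have cK := @rV_compact _ _ (fun _ : 'I_m => `[(-1 : R), 1]%classic)
  (fun _ => @segment_compact R (-1) 1).
have [|l [_ hl]] := cK (u @ \oo)%classic _.
  by exists 0%N => // n _ /= j; rewrite in_itv /= -ler_norml.
exists l => e e0 N.
have [||_ [[n Nn <-] hn]] := hl (u @` [set n | (N <= n)%N])%classic (ball l e).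
- by exists N => // n /= Nn; exists n.
- exact: nbhsx_ballx.
- exists n; split=> // j; case: hn => _ /(_ 0 j).
  by rewrite /ball /= distrC.
Qed.

Section Perturb.
Variable R : realType.
Local Notation C := R[i].

Lemma bolzano_weierstrass_mx r (S : nat -> 'M[C]_r) :
  (forall n, nf (S n) <= 1) -> exists L : 'M[C]_r, forall e, 0 < e ->
    forall N, exists n, (N <= n)%N /\ nf (S n - L) <= e.
Proof.
move=> hS.
pose I := ('I_r * 'I_r * bool)%type.
pose co (M : 'M[C]_r) (x : I) : R :=
  if x.2 then complex.Re (M x.1.1 x.1.2) else complex.Im (M x.1.1 x.1.2).
have nfc (M : 'M[C]_r) : nf M = \sum_x co M x ^+ 2.
  rewrite (eq_bigr (fun p : 'I_r * 'I_r * bool => co M (p.1, p.2) ^+ 2)); last by case.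
  rewrite -(pair_bigA _ (fun p b => co M (p, b) ^+ 2)) /=.
  rewrite (eq_bigr (fun p : 'I_r * 'I_r => sqn (M p.1 p.2))).
    by rewrite -(pair_bigA _ (fun p b => sqn (M p b))).
  by move=> [i j] _; rewrite big_bool.
pose u n : 'rV[R]_#|{: I}| := \row_j co (S n) (enum_val j).
have [|l hl] := @bolzano_weierstrass R _ u.
  move=> n j; rewrite mxE -(@ler_pXn2r _ 2) ?nnegrE // expr1n real_normK ?num_real //.
  apply: le_trans (hS n); rewrite nfc (bigD1 (enum_val j)) //= lerDl.
  by apply: sumr_ge0 => x _; apply: sqr_ge0.
pose lc (x : I) := l 0 (enum_rank x).
exists (\matrix_(i, j) (lc (i, j, true) +i* lc (i, j, false))%C) => e e0 N.
(* With threshold [min 1 (e / c)] the square of each real coordinate difference is at most [e / c],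
   and there are fewer than [c] coordinates. *)
pose c : R := #|{: I}|%:R + 1.
have c0 : 0 < c by rewrite ltr_wpDl.
have [|n [Nn hn]] := hl (Num.min 1 (e / c)) _ N.
  by rewrite lt_min ltr01 divr_gt0.
exists n; split=> //; rewrite nfc.
apply: (@le_trans _ _ (\sum_(x : I) e / c)).
  apply: ler_sum => -[[i j] b] _.
  have := hn (enum_rank (i, j, b)); rewrite /u mxE enum_rankK lt_min => /andP[h1 h2].
  have -> : co (S n - \matrix_(i, j) (lc (i, j, true) +i* lc (i, j, false))%C) (i, j, b) =
     co (S n) (i, j, b) - lc (i, j, b).
    by rewrite /co /= !mxE; case: (S n i j) => p q; case: b {h1 h2}.
  rewrite -real_normK ?num_real // expr2.
  apply: le_trans (ltW h2); rewrite ler_piMl ?normr_ge0 // ltW //.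
rewrite sumr_const -[leLHS]mulr_natr mulrAC ler_pdivrMr // ler_wpM2l //; first exact: ltW.
by rewrite /c lerDl.
Qed.

(* The weighted inequality [|a|^2 <= (1 + t) |b|^2 + (1 + 1/t) |a - b|^2]. *)
Lemma nf_continuous (c eta : R) : 0 <= c -> 0 < eta -> exists2 e : R, 0 < e &
  forall m n (A B : 'M[C]_(m, n)), nf B <= c -> nf (A - B) <= e ->
    nf A <= nf B + eta.
Proof.
move=> c0 eta0.
pose t := eta / (2 * (c + 1)).
have t0 : 0 < t by rewrite divr_gt0 // mulr_gt0 // ltr_wpDl.
have sqnt (x y : C) : sqn x <= (1 + t) * sqn y + (1 + t^-1) * sqn (x - y).
  case: x y => [a b] [p q]; rewrite /sqn /= -subr_ge0.
  have -> : (1 + t) * (p ^+ 2 + q ^+ 2) +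
      (1 + t^-1) * ((a - p) ^+ 2 + (b - q) ^+ 2) - (a ^+ 2 + b ^+ 2) =
      t * ((p - t^-1 * (a - p)) ^+ 2 + (q - t^-1 * (b - q)) ^+ 2).
    by field; rewrite gt_eqF.
  by rewrite mulr_ge0 ?addr_ge0 ?sqr_ge0 // ltW.
have ti0 : 0 < 1 + t^-1 by rewrite addr_gt0 ?invr_gt0.
exists (eta / (2 * (1 + t^-1))); first by rewrite divr_gt0 ?mulr_gt0.
move=> m n A B hB hAB.
have h : nf A <= (1 + t) * nf B + (1 + t^-1) * nf (A - B).
  rewrite /nf !mulr_sumr -big_split; apply: ler_sum => i _.
  rewrite !mulr_sumr -big_split; apply: ler_sum => j _.
  by rewrite !mxE; apply: sqnt.
apply: le_trans h _; rewrite mulrDl mul1r -addrA lerD2l.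
have h1 : t * nf B <= eta / 2.
  apply: (@le_trans _ _ (t * (c + 1))).
    by rewrite ler_wpM2l ?(ltW t0) // (le_trans hB) // lerDl.
  by rewrite /t le_eqVlt; apply/orP; left; apply/eqP; field; rewrite gt_eqF // ltr_wpDl.
have h2 : (1 + t^-1) * nf (A - B) <= eta / 2.
  apply: (@le_trans _ _ ((1 + t^-1) * (eta / (2 * (1 + t^-1))))).
    by rewrite ler_wpM2l // ltW.
  move: (1 + t^-1) ti0 => s s0.
  by rewrite le_eqVlt; apply/orP; left; apply/eqP; field; rewrite gt_eqF.
by apply: le_trans (lerD h1 h2) _; rewrite -splitr.
Qed.

(** By the spectral theorem [q = P^t* D P] with [P] unitary; positivity on the rows of [P] makes [D]
    nonnegative, and [S = P^t* sqrt(D)]. *)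
Lemma psd_factor n (q : 'M[C]_n) : q^t* = q ->
  (forall v : 'rV_n, 0 <= (v *m q *m v^t*) 0 0) -> exists S : 'M[C]_n, q = S *m S^t*.
Proof.
move=> hq hpos.
have hh : q \is hermsymmx by apply/is_hermitianmxP; rewrite expr0 scale1r.
have /orthomx_spectralP := hermitian_normalmx hh.
have := spectral_unitarymx q.
move: (spectralmx q) (spectral_diag q) => P D hP eq1.
have Pu := unitarymx_unit hP.
have D0 j : 0 <= D 0 j.
  have := hpos (row j P); rewrite {1}eq1 invmx_unitary //.
  have PP : P *m P^t* = 1%:M by apply/unitarymxP.
  have -> : row j P *m (P^t* *m diag_mx D *m P) *m (row j P)^t* =
      row j (P *m P^t*) *m diag_mx D *m (P *m (row j P)^t*).
    by rewrite row_mul !mulmxA.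
  have -> : P *m (row j P)^t* = (row j (P *m P^t*))^t*.
    by rewrite row_mul trmx_mul map_mxM trmxCK.
  rewrite PP row1 -rowE mxE (bigD1 j) //= big1 => [|k kj].
    by rewrite !mxE !eqxx /= rmorph1 mulr1 mulr1n addr0.
  by rewrite !mxE eqxx (negPf kj) /= rmorph0 mulr0.
pose E := diag_mx (map_mx sqrtC D).
exists (P^t* *m E).
have EE : E *m E^t* = diag_mx D.
  rewrite /E tr_diag_mx map_diag_mx mulmx_diag; congr diag_mx.
  apply/rowP => j; rewrite !mxE -[RHS]sqrtCK expr2; congr (_ * _).
  have /CrealP : sqrtC (D 0 j) \is Num.real by rewrite ger0_real // sqrtC_ge0.
  exact.
rewrite trmx_mul map_mxM trmxCK mulmxA -(mulmxA (P^t*)) EE -(invmx_unitary hP).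
exact: eq1.
Qed.

End Perturb.

(** * A Perron-Frobenius theorem for irreducible families *)

Lemma conj_mxK (K : numClosedFieldType) m n (A : 'M[K]_(m, n)) :
  map_mx Num.conj (map_mx Num.conj A) = A.
Proof. by apply/matrixP => i j; rewrite !mxE conjCK. Qed.

Section PerronFrobenius.
Variables (R : realType) (d r : nat).
Local Notation C := R[i].
Variable X : 'I_d -> 'M[C]_r.
Hypothesis r_gt0 : (0 < r)%N.
Hypothesis irreducible : forall U : 'M[C]_r,
  (forall i, (U *m X i <= U)%MS) -> U != 0 -> row_full U.
Hypothesis solvable : forall (Y : 'I_d -> 'M[C]_r) (t : R), 0 <= t -> t < 1 ->
  (forall v : 'rV_r, \sum_i nf (v *m Y i) <= t * nf v) ->
  forall rhs : 'M[C]_r, exists z : 'M[C]_r, z - \sum_i X i *m z *m (Y i)^T = rhs.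

(** With [q = S *m S^t*] and the completely positive map [Psi] defined below, this says
    [t Psi(q) <= q]: [q] is a subinvariant vector of [Psi]. For invertible [S] and [t = 1] it makes
    the matrices [S^-1 X_i S] a row contraction. *)
Definition sub_invariant t (S : 'M[C]_r) :=
  forall z : 'rV[C]_r, t * \sum_i nf (z *m X i *m S) <= nf (z *m S).

Let good t := exists2 S : 'M[C]_r, S != 0 & sub_invariant t S.

Lemma sub_invariant_le t t' S : t' <= t -> sub_invariant t S -> sub_invariant t' S.
Proof.
move=> tt h z; apply: le_trans (h z); rewrite ler_wpM2r //.
by apply: sumr_ge0 => i _; apply: nf_ge0.
Qed.

Lemma good_normalized t : good t -> exists2 S, nf S = 1 & sub_invariant t S.
Proof.
case=> S S0 hS; have nS : 0 < nf S by rewrite lt_def nf_eq0 S0 nf_ge0.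
pose a : R := (Num.sqrt (nf S))^-1.
have na : sqn a%:C%C = (nf S)^-1 by rewrite sqnR exprVn sqr_sqrtr // ltW.
exists (a%:C%C *: S); first by rewrite nfZ na mulVf // gt_eqF.
move=> z; under eq_bigr do rewrite -scalemxAr nfZ na.
rewrite -mulr_sumr mulrCA -scalemxAr nfZ na ler_pM2l ?invr_gt0 //.
Qed.

(** The left kernel of [S] is stable under every [X i], since [z S = 0] forces [z X_i S = 0]. By
    irreducibility a nonzero kernel would be everything, and [S] would vanish. *)
Lemma sub_invariant_unit t S : 0 < t -> S != 0 -> sub_invariant t S -> S \in unitmx.
Proof.
move=> t0 S0 hS; rewrite -row_free_unit -kermx_eq0.
apply: contraNT S0 => /(irreducible _) full.
have /full : forall i, (kermx S *m X i <= kermx S)%MS.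
  move=> i; apply/sub_kermxP/row_matrixP => k.
  rewrite row_mul row_mul row0.
  have := hS (row k (kermx S)).
  have -> : row k (kermx S) *m S = 0 by rewrite -row_mul mulmx_ker row0.
  rewrite nf0 pmulr_rle0 // => h.
  have : \sum_i nf (row k (kermx S) *m X i *m S) == 0.
    by rewrite eq_le h /=; apply: sumr_ge0 => j _; apply: nf_ge0.
  rewrite psumr_eq0; last by move=> j _; apply: nf_ge0.
  by move=> /allP/(_ i); rewrite mem_index_enum => /(_ isT) /=; rewrite nf_eq0 => /eqP.
rewrite row_full_unit => ku; apply/eqP.
by rewrite -[S](mulKmx ku) mulmx_ker mulmx0.
Qed.

Lemma good_small : exists2 t : R, 0 < t <= 1 & good t.
Proof.
pose s : R := \sum_i nf (X i).
have s0 : 0 <= s by apply: sumr_ge0 => i _; apply: nf_ge0.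
have s1 : 0 < 1 + s by rewrite ltr_wpDr.
exists (1 + s)^-1.
  by rewrite invr_gt0 s1 /= invf_le1 // lerDl.
exists 1%:M.
  apply/eqP => /matrixP/(_ (Ordinal r_gt0) (Ordinal r_gt0)).
  by rewrite !mxE eqxx; apply/eqP; rewrite oner_eq0.
move=> z; rewrite mulmx1 mulrC ler_pdivrMr //.
apply: (@le_trans _ _ (nf z * s)).
  by rewrite mulr_sumr; apply: ler_sum => i _; rewrite mulmx1 nfM.
by rewrite ler_wpM2l ?nf_ge0 // lerDr.
Qed.

(** Normalized solutions for parameters increasing to [t] have a limit point by compactness. It is
    nonzero because of the normalization, and the inequality passes to the limit. *)
Lemma good_closed (t : R) : 0 < t -> (forall t' : R, t' < t -> good t') -> good t.
Proof.
move=> t0 ht.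
have hn n : exists S, nf S = 1 /\ sub_invariant (t * (1 - n.+1%:R^-1)) S.
  have [|S nS hS] := @good_normalized (t * (1 - n.+1%:R^-1)).
    apply: ht; rewrite -{2}(mulr1 t) ltr_pM2l // gtrBl invr_gt0 ltr0n //.
  by exists S.
have [S hS] := choice hn.
have [n|L hL] := @bolzano_weierstrass_mx R r S; first by rewrite (hS n).1.
have nL eta : 0 < eta -> nf L <= 1 + eta.
  move=> eta0; have [e e0 he] := nf_continuous ler01 eta0.
  have [n [_ hn']] := hL e e0 0%N.
  rewrite -(hS n).1; apply: he; first by rewrite (hS n).1.
  by rewrite -opprB nfN.
exists L.
  apply/eqP => L0; have [|e e0 he] := nf_continuous ler01 (_ : 0 < 2^-1 :> R).
    by rewrite invr_gt0.
  have [n [_ hn']] := hL e e0 0%N.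
  have := he _ _ (S n) L; rewrite (hS n).1 L0 nf0 add0r => /(_ ler01).
  rewrite -{1}L0 => /(_ hn'); lra.
move=> z; apply/ler_addgt0Pr => eta eta0.
have z0 := nf_ge0 z.
pose B : R := nf z * 2 + \sum_i nf (z *m X i) * 2.
have sX0 : 0 <= \sum_i nf (z *m X i) * 2.
  by apply: sumr_ge0 => i _; rewrite mulr_ge0 ?nf_ge0.
have B0 : 0 <= B by rewrite addr_ge0 ?mulr_ge0.
have BXi i : nf (z *m X i) * 2 <= B.
  rewrite /B (bigD1 i) //= addrCA lerDl addr_ge0 ?mulr_ge0 //.
  by apply: sumr_ge0 => j _; rewrite mulr_ge0 ?nf_ge0.
(* Three errors occur: [S n] replaced by [L] on the right, the same in the [d] terms on the left,
   and [t] replaced by [t (1 - 1/(n+1))]. They cost [eta'], [t d eta'] and [t B eta'], in total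
   [eta]. *)
pose eta' := eta / (1 + t * d%:R + t * B).
have den0 : 0 < 1 + t * d%:R + t * B.
  by rewrite -addrA ltr_wpDr // addr_ge0 ?mulr_ge0 // ltW.
have eta'0 : 0 < eta' by rewrite divr_gt0.
have [e e0 he] := nf_continuous B0 eta'0.
pose c : R := nf z + \sum_i nf (z *m X i) + 1.
have sX1 : 0 <= \sum_i nf (z *m X i) by apply: sumr_ge0 => i _; apply: nf_ge0.
have c0 : 0 < c by rewrite ltr_wpDl // addr_ge0.
have cXi i : nf (z *m X i) <= c.
  rewrite /c (bigD1 i) //= addrCA -addrA lerDl !addr_ge0 //.
  by apply: sumr_ge0 => j _; apply: nf_ge0.
have cz : nf z <= c.
  by rewrite /c -addrA lerDl addr_ge0 // sumr_ge0 // => j _; apply: nf_ge0.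
pose N := Num.truncn eta'^-1.
have [n [Nn hn']] := hL (e / c) (divr_gt0 e0 c0) N.
have sn : nf (S n) = 1 := (hS n).1.
have near (u : 'rV[C]_r) : nf u <= c -> nf (u *m S n - u *m L) <= e.
  move=> hu; rewrite -mulmxBr; apply: le_trans (nfM _ _) _.
  apply: (@le_trans _ _ (c * (e / c))); first by rewrite ler_pM ?nf_ge0.
  by rewrite mulrCA divff ?mulr1 // gt_eqF.
have L2 : nf L <= 2 by apply: le_trans (nL 1 ltr01) _.
have hz : nf (z *m S n) <= nf (z *m L) + eta'.
  apply: he; last exact: near.
  apply: le_trans (nfM _ _) _; apply: (@le_trans _ _ (nf z * 2)).
    by rewrite ler_wpM2l.
  by rewrite /B lerDl.
have hX i : nf (z *m X i *m L) <= nf (z *m X i *m S n) + eta'.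
  apply: he; last by rewrite -opprB nfN near.
  apply: le_trans (nfM _ _) _; rewrite sn mulr1; apply: le_trans (BXi i).
  by rewrite ler_peMr ?nf_ge0 // ler1n.
have hsum : \sum_i nf (z *m X i *m L) <= \sum_i nf (z *m X i *m S n) + d%:R * eta'.
  apply: (@le_trans _ _ (\sum_i (nf (z *m X i *m S n) + eta'))); first exact: ler_sum.
  by rewrite big_split /= sumr_const card_ord mulr_natl.
have sB : \sum_i nf (z *m X i *m S n) <= B.
  apply: (@le_trans _ _ (\sum_i nf (z *m X i) * 2)); last by rewrite /B lerDr mulr_ge0.
  apply: ler_sum => i _; apply: le_trans (nfM _ _) _.
  by rewrite sn mulr1 ler_peMr ?nf_ge0 // ler1n.
have hSn := (hS n).2 z.
have hninv : n.+1%:R^-1 <= eta'.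
  rewrite -[leRHS]invrK lef_pV2 ?posrE ?invr_gt0 ?ltr0n //.
  have /andP[_ h] : N%:R <= eta'^-1 < N.+1%:R by rewrite truncn_itv // invr_ge0 ltW.
  by apply: le_trans (ltW h) _; rewrite ler_nat ltnS.
have s0 : 0 <= \sum_i nf (z *m X i *m S n) by apply: sumr_ge0 => i _; apply: nf_ge0.
have e1 : eta = eta' + t * d%:R * eta' + t * B * eta'.
  by rewrite /eta'; field; rewrite gt_eqF.
have t1 : t * \sum_i nf (z *m X i *m L) <=
    t * \sum_i nf (z *m X i *m S n) + t * d%:R * eta'.
  by rewrite -mulrA -mulrDr ler_wpM2l // ltW.
have t2 : t * n.+1%:R^-1 * \sum_i nf (z *m X i *m S n) <= t * B * eta'.
  rewrite -!mulrA ler_wpM2l ?(ltW t0) // mulrC ler_pM // invr_ge0 //.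
move: hSn; rewrite mulrBr mulr1 mulrBl => hSn.
have lin (a s v e' w x y q : R) : a <= s + x -> q <= y -> s - q <= v ->
    v <= w + e' -> a <= w + (e' + x + y) by move=> *; lra.
by rewrite e1; exact: lin t1 t2 hSn hz.
Qed.

Let Psi (z : 'M[C]_r) := \sum_i X i *m z *m (X i)^t*.

(** The tuple [Y i = t conj(S^-1 X_i S)] satisfies the hypothesis of [solvable]. The solution [z]
    gives [w = z S^t*] with [w - t Psi(w) = 1], and [h = w + w^t*] is hermitian with right side
    2. *)
Lemma resolvent_herm t S : 0 < t -> t < 1 -> S \in unitmx -> sub_invariant t S ->
  exists h : 'M[C]_r, h^t* = h /\ h - t%:C%C *: Psi h = 2%:M.
Proof.
move=> t0 t1 Su hS.
pose Y i := t%:C%C *: map_mx Num.conj (invmx S *m X i *m S).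
have hY (v : 'rV_r) : \sum_i nf (v *m Y i) <= t * nf v.
  have e i : nf (v *m Y i) = t ^+ 2 * nf (map_mx Num.conj v *m invmx S *m X i *m S).
    rewrite -scalemxAr nfZ sqnR; congr (_ * _).
    by rewrite -[LHS]nfJ map_mxM conj_mxK !mulmxA.
  under eq_bigr do rewrite e.
  rewrite -mulr_sumr expr2 -mulrA ler_wpM2l ?(ltW t0) //.
  apply: le_trans (hS _) _.
  by rewrite mulmxKV // nfJ.
have [z hz] := solvable (ltW t0) t1 hY ((invmx S)^t*).
pose w := z *m S^t*.
have hw : w - t%:C%C *: Psi w = 1%:M.
  have <- : (invmx S)^t* *m S^t* = 1%:M.
    by rewrite -map_mxM -trmx_mul mulmxV // trmx1 map_mx1.
  rewrite -hz mulmxBl; congr (_ - _).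
  rewrite /Psi scaler_sumr mulmx_suml; apply: eq_bigr => i _.
  rewrite /Y linearZ /= -scalemxAr -scalemxAl; congr (_ *: _).
  rewrite /w -!mulmxA; congr (_ *m (_ *m _)).
  rewrite [in RHS]map_trmx -!map_mxM -!trmx_mul; congr (_^t*).
  by rewrite !mulmxA mulmxV // mul1mx.
have PsiC (u : 'M[C]_r) : (Psi u)^t* = Psi (u^t*).
  rewrite /Psi raddf_sum /= raddf_sum /=; apply: eq_bigr => i _.
  by rewrite !trmx_mul !map_mxM trmxCK mulmxA.
have PsiD (u v : 'M[C]_r) : Psi (u + v) = Psi u + Psi v.
  rewrite /Psi -big_split; apply: eq_bigr => i _.
  by rewrite mulmxDr mulmxDl.
exists (w + w^t*); split.
  by rewrite raddfD /= raddfD /= trmxCK addrC.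
rewrite PsiD scalerDr opprD addrACA hw.
have -> : w^t* - t%:C%C *: Psi (w^t*) = (w - t%:C%C *: Psi w)^t*.
  rewrite raddfB /= raddfB /= -PsiC; congr (_ - _).
  by rewrite linearZ /= map_mxZ /=; congr (_ *: _); symmetry; exact: conjc_real.
by rewrite hw trmx1 map_mx1 -raddfD.
Qed.

(** The form [S S^t*] is perturbed to [q = S S^t* + e h], with [h] from [resolvent_herm]. Then
    [q - t Psi(q) >= 2 e], a strict margin that allows a larger parameter; [psd_factor] writes [q]
    as [S' S'^t*]. *)
Lemma good_open (t : R) : 0 < t -> t < 1 -> good t -> exists2 t', t < t' & good t'.
Proof.
move=> t0 t1 [S S0 hS].
have Su := sub_invariant_unit t0 S0 hS.
have [h [hh hP]] := resolvent_herm t0 t1 Su hS.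
have nfv (m : nat) (v : 'M[C]_(1, m)) : (v *m v^t*) 0 0 = (nf v)%:C%C.
  by rewrite nfE /mxtrace big_ord1.
pose b (v : 'rV[C]_r) : R := complex.Re ((v *m h *m v^t*) 0 0).
have hb v : (v *m h *m v^t*) 0 0 = (b v)%:C%C.
  rewrite /b RRe_real //; apply/CrealP.
  transitivity (((v *m h *m v^t*)^t*) 0 0); first by rewrite !mxE.
  by rewrite !trmx_mul !map_mxM trmxCK hh mulmxA.
have h0 := nf_ge0 h.
have bb v : `|b v| <= (nf h + 1) * nf v.
  have v0 := nf_ge0 v.
  rewrite -(@ler_pXn2r _ 2) ?nnegrE ?mulr_ge0 ?addr_ge0 //.
  rewrite real_normK ?num_real //.
  have -> : b v ^+ 2 = nf (v *m h *m v^t*).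
    by rewrite /nf !big_ord1 hb sqnR.
  apply: le_trans (nfM _ _) _; rewrite nfJ nf_tr.
  apply: (@le_trans _ _ (nf v * nf h * nf v)); first by rewrite ler_wpM2r ?nfM.
  have -> : nf v * nf h * nf v = nf v ^+ 2 * nf h by ring.
  rewrite exprMn mulrC ler_wpM2r ?sqr_ge0 //.
  have := sqr_ge0 (nf h); nra.
pose iS := invmx S.
(* So small that [e |b v| <= nf (v *m S)], because [nf v <= nf (v *m S) * nf iS]. *)
pose e : R := (1 + (nf h + 1) * nf iS)^-1.
have den : 0 < 1 + (nf h + 1) * nf iS.
  by rewrite ltr_wpDr // mulr_ge0 ?addr_ge0 ?nf_ge0.
have e0 : 0 < e by rewrite invr_gt0.
pose Q v := nf (v *m S) + e * b v.
have Q0 v : 0 <= Q v.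
  have hv : nf v <= nf (v *m S) * nf iS.
    by rewrite -{1}(mulmxK Su v) nfM.
  have := bb v; rewrite ler_norml => /andP[h1 _].
  rewrite /Q -lerBlDr sub0r; apply: (@le_trans _ _ (e * ((nf h + 1) * (nf (v *m S) * nf iS)))).
    rewrite -mulrN ler_wpM2l ?(ltW e0) // lerNl.
    by apply: le_trans h1; rewrite lerN2 ler_wpM2l ?addr_ge0.
  rewrite /e mulrC ler_pdivrMr // mulrDr mulr1.
  have -> : (nf h + 1) * (nf (v *m S) * nf iS) = nf (v *m S) * ((nf h + 1) * nf iS) by ring.
  by rewrite lerDr nf_ge0.
pose q := S *m S^t* + e%:C%C *: h.
have hq v : (v *m q *m v^t*) 0 0 = (Q v)%:C%C.
  rewrite /q mulmxDr mulmxDl -scalemxAr -scalemxAl.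
  have -> : v *m (S *m S^t*) *m v^t* = (v *m S) *m (v *m S)^t*.
    by rewrite trmx_mul map_mxM !mulmxA.
  by rewrite [LHS]mxE [X in _ + X]mxE nfv hb rmorphD rmorphM.
have [|v|S' hS'] := @psd_factor R r q.
- rewrite /q raddfD /= raddfD /= trmx_mul map_mxM trmxCK; congr (_ + _).
  rewrite linearZ /= map_mxZ /= hh; congr (_ *: _); exact: conjc_real.
- by rewrite hq ler0c.
have nQ (v : 'rV[C]_r) : nf (v *m S') = Q v.
  apply: complexI; rewrite -hq hS' -nfv trmx_mul map_mxM.
  by rewrite !mulmxA.
have bsum v : b v - t * \sum_i b (v *m X i) = 2 * nf v.
  apply: complexI; rewrite rmorphB rmorphM rmorph_sum /=.
  have -> : \sum_i (b (v *m X i))%:C%C = (v *m Psi h *m v^t*) 0 0.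
    rewrite /Psi mulmx_sumr mulmx_suml summxE; apply: eq_bigr => i _.
    by rewrite -hb trmx_mul map_mxM !mulmxA.
  rewrite -hb.
  transitivity ((v *m (h - t%:C%C *: Psi h) *m v^t*) 0 0).
    by rewrite mulmxBr mulmxBl -scalemxAr -scalemxAl !mxE.
  rewrite hP mul_mx_scalar -scalemxAl mxE nfv [RHS]rmorphM /=; congr (_ * _).
  by rewrite rmorph_nat.
have Qsum v : Q v - t * \sum_i Q (v *m X i) >= e * (2 * nf v).
  rewrite /Q big_split /= -mulr_sumr -bsum.
  have := hS v; set s1 := \sum_i _; set s2 := \sum_i _ => hSv.
  have -> : nf (v *m S) + e * b v - t * (s1 + e * s2) =
    (nf (v *m S) - t * s1) + e * (b v - t * s2) by ring.
  by rewrite lerDr subr_ge0.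
pose c : R := \sum_i nf (X i *m S').
have c0 : 0 <= c by apply: sumr_ge0 => i _; apply: nf_ge0.
have cQ v : \sum_i Q (v *m X i) <= c * nf v.
  rewrite mulr_suml; apply: ler_sum => i _.
  by rewrite -nQ -mulmxA mulrC nfM.
have c1 : 0 < c + 1 by rewrite ltr_wpDl.
(* Since [\sum_i Q (v *m X i) <= c * nf v], the margin [2 e nf v] covers this increase of [t]. *)
exists (t + e * 2 / (c + 1)); first by rewrite ltrDl divr_gt0 ?mulr_gt0.
exists S'.
  apply/eqP => S'0; pose v : 'rV[C]_r := const_mx 1.
  have vn0 : v != 0.
    apply/eqP => /rowP/(_ (Ordinal r_gt0)); rewrite !mxE; apply/eqP.
    exact: oner_neq0.
  have Qz u : Q u = 0 by rewrite -nQ S'0 mulmx0 nf0.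
  have := Qsum v; rewrite Qz big1 // mulr0 subr0 leNgt.
  by rewrite !mulr_gt0 // lt_def nf_eq0 vn0 nf_ge0.
move=> v; under eq_bigr do rewrite nQ.
rewrite nQ mulrDl; have := Qsum v; set s := \sum_i _ => hs.
have h3 : e * 2 / (c + 1) * s <= e * (2 * nf v).
  rewrite -mulrA [e * (2 * _)]mulrA ler_wpM2l ?mulr_ge0 ?(ltW e0) //.
  rewrite mulrC ler_pdivrMr //; apply: le_trans (cQ v) _.
  by rewrite mulrC ler_wpM2l ?nf_ge0 // lerDl.
have lin (a b' y z : R) : y <= a - b' -> z <= y -> b' + z <= a by move=> *; lra.
exact: lin hs h3.
Qed.

(** The supremum [t] of the good parameters at most 1 is itself good by [good_closed], and [t < 1]
    would contradict [good_open]. *)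
Lemma perron_frobenius : exists2 S : 'M[C]_r, S \in unitmx &
  forall z : 'rV[C]_r, \sum_i nf (z *m X i *m S) <= nf (z *m S).
Proof.
have [s /andP[s0 s1] gs] := good_small.
pose E := [set t : R | t <= 1 /\ good t]%classic.
have hE : has_sup E.
  by split; [exists s | exists 1 => t []].
pose t := sup E.
have st : s <= t by apply: ub_le_sup => //; case: hE.
have t0 : 0 < t by apply: lt_le_trans st.
have t1 : t <= 1 by apply: ge_sup; [case: hE | move=> u []].
have gt : good t.
  apply: good_closed => // t' tt'.
  have [u [_ [S S0 hS]] tu] := sup_gt hE.1 tt'.
  by exists S => //; apply: sub_invariant_le hS; apply: ltW.
have {t1} [t1|t1] : t < 1 \/ t = 1.
  by case: ltgtP t1 => // h _; [left|right].
  have [t' tt' [S S0 hS]] := good_open t0 t1 gt.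
  have : Num.min t' 1 <= t.
    apply: ub_le_sup; first by case: hE.
    split; first by rewrite ge_min lexx orbT.
    by exists S => //; apply: sub_invariant_le hS; rewrite ge_min lexx.
  by rewrite leNgt lt_min tt' t1.
case: gt => S S0 hS; exists S; first exact: sub_invariant_unit t0 S0 hS.
by move=> z; have := hS z; rewrite t1 mul1r.
Qed.

End PerronFrobenius.

(** * Tensor products and evaluation *)

Section Tensor.
Variable C : fieldType.

Lemma tensmxDl m n p q (A1 A2 : 'M[C]_(m, n)) (B : 'M[C]_(p, q)) :
  tensmx (A1 + A2) B = tensmx A1 B + tensmx A2 B.
Proof. by apply/matrixP => i j; rewrite !mxE mulrDl. Qed.

Lemma tensmxNl m n p q (A : 'M[C]_(m, n)) (B : 'M[C]_(p, q)) :
  tensmx (- A) B = - tensmx A B.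
Proof. by apply/matrixP => i j; rewrite !mxE mulNr. Qed.

Lemma tensmx1 m n : tensmx (1%:M : 'M[C]_m) (1%:M : 'M[C]_n) = 1%:M.
Proof.
apply/matrixP => i j.
case: (mxtens_indexP i) => i0 i1; case: (mxtens_indexP j) => j0 j1.
rewrite tensmxE !mxE (can_eq (@mxtens_indexK m n)) xpair_eqE.
by rewrite -natrM mulnb.
Qed.

(** Flattening a matrix turns the action of [A (x) 1] into right multiplication by [A]. The next
    lemma is the vectorization identity [(A (x) B) vec Z = vec (A Z B^T)]. *)
Lemma tensmx_row m n p (Z : 'M[C]_(p, m)) (A : 'M[C]_(m, n)) :
  (\row_k Z (mxtens_unindex k).2 (mxtens_unindex k).1) *m tensmx A (1%:M : 'M_p) =
  \row_k (Z *m A) (mxtens_unindex k).2 (mxtens_unindex k).1.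
Proof.
apply/rowP => k; rewrite !mxE big_mxtens; case: (mxtens_indexP k) => i j.
rewrite mxtens_indexK; apply: eq_bigr => l _.
rewrite (bigD1 j) // big1 => [|j' j'j]; rewrite tensmxE !mxE mxtens_indexK.
  by rewrite /= eqxx mulr1 addr0.
by rewrite /= (negPf j'j) mulr0n !mulr0.
Qed.

Lemma tensmx_col m n p q (Z : 'M[C]_(n, q)) (A : 'M[C]_(m, n)) (B : 'M[C]_(p, q)) :
  tensmx A B *m (\col_k Z (mxtens_unindex k).1 (mxtens_unindex k).2) =
  \col_k (A *m Z *m B^T) (mxtens_unindex k).1 (mxtens_unindex k).2.
Proof.
apply/colP => k; rewrite !mxE big_mxtens; case: (mxtens_indexP k) => i j.
rewrite mxtens_indexK exchange_big; apply: eq_bigr => l _.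
rewrite !mxE mulr_suml; apply: eq_bigr => i' _.
by rewrite tensmxE !mxE mxtens_indexK mulrAC.
Qed.

Lemma tensmx_solve d r m (X : 'I_d -> 'M[C]_r) (Y : 'I_d -> 'M[C]_m) :
  1%:M - \sum_i tensmx (X i) (Y i) \in unitmx ->
  forall rhs : 'M[C]_(r, m), exists z, z - \sum_i X i *m z *m (Y i)^T = rhs.
Proof.
move=> Mu rhs.
pose vec (z : 'M[C]_(r, m)) := \col_k z (mxtens_unindex k).1 (mxtens_unindex k).2.
have vecK (z z' : 'M[C]_(r, m)) : vec z = vec z' -> z = z'.
  move=> /colP h; apply/matrixP => i j; have := h (mxtens_index (i, j)).
  by rewrite !mxE mxtens_indexK.
have vec_surj (c : 'cV[C]_(r * m)) : exists z, vec z = c.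
  exists (\matrix_(i, j) c (mxtens_index (i, j)) 0).
  by apply/colP => k; rewrite !mxE -surjective_pairing mxtens_unindexK.
have [z hz] := vec_surj (invmx (1%:M - \sum_i tensmx (X i) (Y i)) *m vec rhs).
exists z; apply: vecK.
have <- : (1%:M - \sum_i tensmx (X i) (Y i)) *m vec z = vec rhs.
  by rewrite hz mulKVmx.
rewrite mulmxBl mul1mx mulmx_suml.
apply/colP => k; rewrite mxE [RHS]mxE !mxE; congr (_ - _).
rewrite !summxE; apply: eq_bigr => i _.
by rewrite /vec tensmx_col [RHS]mxE mxE.
Qed.

Definition mxword d m (Y : 'I_d -> 'M[C]_m) (w : seq 'I_d) : 'M[C]_m :=
  \prod_(i <- w) Y i.

Lemma mxword_cons d m (Y : 'I_d -> 'M[C]_m) i w :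
  mxword Y (i :: w) = Y i *m mxword Y w.
Proof. by rewrite /mxword big_cons. Qed.

Lemma mxword_nil d m (Y : 'I_d -> 'M[C]_m) : mxword Y [::] = 1%:M.
Proof. by rewrite /mxword big_nil. Qed.

Definition evalser d a b m N (f : seq 'I_d -> 'M[C]_(a, b)) (Y : 'I_d -> 'M[C]_m) :
  'M[C]_(a * m, b * m) :=
  \sum_(n < N) \sum_(w <- words d n) tensmx (f w) (mxword Y w).

End Tensor.

(** * Linear algebra *)

Section LinearAlgebra.
Variable C : fieldType.

(** [U] has maximal rank among the matrices whose row space satisfies [P]; adjoining a further
    vector of [P] cannot raise this rank. *)
Lemma subspace_mx N (P : 'rV[C]_N -> Prop) : P 0 ->
  (forall a u v, P u -> P v -> P (a *: u + v)) ->
  exists U : 'M[C]_N, forall v : 'rV_N, (v <= U)%MS <-> P v.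
Proof.
move=> P0 PD.
pose ok n := exists U : 'M[C]_N, (forall v : 'rV_N, (v <= U)%MS -> P v) /\ \rank U = n.
have ok0 : exists n, `[< ok n >].
  exists 0%N; apply/asboolP; exists 0; split; last exact: mxrank0.
  by move=> v; rewrite submx0 => /eqP->.
have okN n : `[< ok n >] -> (n <= N)%N.
  by move=> /asboolP[U [_ <-]]; apply: rank_leq_row.
have [n /asboolP[U [hU rU]] nmax] := ex_maxnP ok0 okN.
exists U => v; split; first exact: hU.
move=> Pv; have : (\rank (U + v)%MS <= \rank U)%N.
  rewrite rU; apply: nmax; apply/asboolP; exists (U + v)%MS; split=> // w.
  case/sub_addsmxP => -[a b] /= ->; rewrite addrC [b]mx11_scalar mul_scalar_mx.
  by apply: PD => //; apply: hU; apply: submxMl.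
rewrite (geq_leqif (mxrank_leqif_sup (addsmxSl U v))) => h.
exact: submx_trans (addsmxSr U v) h.
Qed.

(** One linear section of [O] respects all steps of the filtration at once. In the induction the old
    section is kept on the image of [W j], through the projection [p], and the rest is lifted into
    [W j.+1] by a pseudo-inverse. *)
Lemma filtered_section N K (W : nat -> 'M[C]_N) (O : 'M[C]_(N, K)) :
  (forall i j, (i <= j)%N -> (W i <= W j)%MS) ->
  forall j, exists s : 'M[C]_(K, N), forall i, (i <= j)%N ->
    forall a (c : 'M[C]_(a, K)), (c <= W i *m O)%MS ->
    (c *m s <= W i)%MS /\ c *m s *m O = c.
Proof.
have mxA4 a b e (c : 'M[C]_(a, b)) (P : 'M_(b, e)) (Z : 'M_(e, N)) :
    c *m (P *m Z) *m O = c *m P *m (Z *m O) by rewrite !mulmxA.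
move=> mono; elim=> [|j [s IH]].
  exists (pinvmx (W 0%N *m O) *m W 0%N) => i; rewrite leqn0 => /eqP-> a c hc.
  split; first by rewrite mulmxA submxMl.
  by rewrite mxA4 mulmxKpV.
pose E := W j *m O; pose p := pinvmx E *m E.
have pE a (c : 'M[C]_(a, K)) : (c <= E)%MS -> c *m p = c.
  by move=> hc; rewrite /p mulmxA mulmxKpV.
pose t := pinvmx (W j.+1 *m O) *m W j.+1.
have tE a (c : 'M[C]_(a, K)) : (c <= W j.+1 *m O)%MS -> c *m t *m O = c.
  by move=> hc; rewrite /t mxA4 mulmxKpV.
exists (p *m s + (1%:M - p) *m t) => i; rewrite leq_eqVlt => /orP[/eqP->|hi] a c hc.
  have hcp : (c *m p <= E)%MS by rewrite /p mulmxA submxMl.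
  have [h1 h2] := IH j (leqnn j) _ _ hcp.
  have -> : c *m (p *m s + (1%:M - p) *m t) = c *m p *m s + (c - c *m p) *m t.
    by rewrite mulmxDr (mulmxA c p s) (mulmxA c _ t) mulmxBr mulmx1.
  split.
    rewrite addmx_sub //; last by rewrite /t mulmxA submxMl.
    exact: submx_trans h1 (mono _ _ (leqnSn j)).
  rewrite mulmxDl h2 tE; first by rewrite addrC subrK.
  rewrite addmx_sub // eqmx_opp; apply: submx_trans hcp _.
  by apply: submxMr; apply: mono.
have hcE : (c <= E)%MS.
  by apply: submx_trans hc _; apply: submxMr; apply: mono; rewrite -ltnS.
rewrite mulmxDr (mulmxA c p s) (mulmxA c _ t) mulmxBr mulmx1 pE // subrr mul0mx addr0.
exact: IH.
Qed.

(** The rows of [B] represent a basis of [W / U], and [Q] reads off coordinates in it. *)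
Lemma quotient_coordinates N (U W : 'M[C]_N) : (U <= W)%MS -> ~~ (W <= U)%MS ->
  exists (r : nat) (B : 'M[C]_(r, N)) (Q : 'M[C]_(N, r)),
    [/\ (0 < r)%N, (B <= W)%MS, B *m Q = 1%:M, U *m Q = 0 &
        forall a (V : 'M[C]_(a, N)), (V <= W)%MS -> (V - V *m Q *m B <= U)%MS].
Proof.
move=> UW WU; pose D := (W :\: U)%MS.
have dx : (D :&: U = 0)%MS by apply: capmx_diff.
have WD : (W <= D + U)%MS.
  rewrite -(addsmx_diff_cap_eq W U); apply: addsmxS => //; exact: capmxSr.
pose B := row_base D; pose Q := proj_mx D U *m pinvmx B.
have Bfree : B *m pinvmx B = 1%:M by rewrite mulmxVp ?row_base_free.
exists (\rank D), B, Q; split.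
- rewrite lt0n mxrank_eq0; apply: contra WU => /eqP D0.
  by apply: submx_trans WD _; rewrite D0 addsmx_sub sub0mx /=.
- by rewrite eq_row_base diffmxSl.
- by rewrite /Q mulmxA proj_mx_id ?Bfree // eq_row_base.
- by rewrite /Q mulmxA proj_mx_0 // mul0mx.
move=> a V VW; rewrite /Q mulmxA mulmxKpV ?eq_row_base ?proj_mx_sub //.
by apply: proj_mx_compl_sub; apply: submx_trans VW WD.
Qed.

End LinearAlgebra.

(** * Factorization of nonsingular polynomials *)

Section Structure.
Variables (R : realType) (d K D N : nat).
Local Notation C := R[i].
Local Notation word := (seq 'I_d).
Local Notation ser a b := (word -> 'M[C]_(a, b)).

(* The rows of [Omega] form a basis of the row polynomials of degree at most
   [D], so that [v *m Omega w] is the coefficient at [w] of the polynomial with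
   coordinates [v]. *)
Variable Omega : ser N K.
Hypothesis Omega_deg : vanish_above D Omega.
Hypothesis Omega_span : forall a (h : ser a K), vanish_above D h ->
  exists V : 'M[C]_(a, N), forall w, h w = V *m Omega w.
Hypothesis Omega_free : forall a (V : 'M[C]_(a, N)),
  (forall w, V *m Omega w = 0) -> V = 0.

Definition left_multiple (f : ser K K) (v : 'rV[C]_N) := exists n (p : ser 1 K),
  vanish_above n p /\ forall w, v *m Omega w = conv p f w.

Definition row_contractive m t (Y : 'I_d -> 'M[C]_m) :=
  forall v : 'rV_m, \sum_i nf (v *m Y i) <= t * nf v.

(** As [f] has invertible constant term, the constant term of [p] vanishes; then the left
    derivatives of [p] satisfy the same equation. *)
Lemma conv_eq0 a (p : ser a K) (f : ser K K) : f [::] \in unitmx ->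
  (forall w, conv p f w = 0) -> forall w, p w = 0.
Proof.
move=> fu h w; elim: w p h => [|i w IH] p h.
  by have := h [::]; rewrite /= => /(congr1 (mulmxr (invmx (f [::])))) /=; rewrite mulmxK // mul0mx.
have p0 : p [::] = 0.
  by have := h [::]; rewrite /= => /(congr1 (mulmxr (invmx (f [::])))) /=; rewrite mulmxK // mul0mx.
apply: (IH (fun u => p (i :: u))) => u.
by have := h (i :: u); rewrite /= p0 mul0mx add0r.
Qed.

Lemma conv_inj a (p q : ser a K) (f : ser K K) : f [::] \in unitmx ->
  (forall w, conv p f w = conv q f w) -> forall w, p w = q w.
Proof.
move=> fu h w; apply/eqP; rewrite -subr_eq0; apply/eqP.
apply: (@conv_eq0 a (fun u => p u - q u) f fu) => u.
by rewrite convBl h subrr.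
Qed.

Lemma left_multiple_mx (f : ser K K) :
  exists U : 'M[C]_N, forall v : 'rV_N, (v <= U)%MS <-> left_multiple f v.
Proof.
apply: subspace_mx.
  by exists 0%N, (fun=> 0); split=> // w; rewrite mul0mx conv0l.
move=> a u v [m [p [hp up]]] [n [q [hq vq]]].
exists (maxn m n), (fun w => a%:M *m p w + q w); split.
  move=> w; rewrite gtn_max => /andP[mw nw].
  by rewrite hp // hq // mulmx0 addr0.
by move=> w; rewrite convDl convMl mulmxDl -scalemxAl up vq mul_scalar_mx.
Qed.

(** * Realization of the quotients by a fixed polynomial *)

Section Fixed.
Variable f : ser K K.
Hypothesis f_deg : vanish_above D f.
Hypothesis f_unit : f [::] \in unitmx.
Hypothesis f_nonsing : forall m (Y : 'I_d -> 'M[C]_m) (t : R),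
  (0 < m)%N -> 0 <= t -> t < 1 -> row_contractive t Y ->
  evalser D.+1 f Y \in unitmx.

(** [A i] sends a row polynomial [h] to its left derivative by [i] minus [h_0 f_0^-1] times that of
    [f], where [h_0] and [f_0] are the constant terms. *)
Variable A : 'I_d -> 'M[C]_N.
Hypothesis A_Omega : forall i w,
  Omega (i :: w) = A i *m Omega w + Omega [::] *m invmx (f [::]) *m f (i :: w).

(** The series [Omega f^-1], given by a linear representation with transition matrices [A i]. *)
Fixpoint Theta (w : word) : 'M[C]_(N, K) :=
  if w is i :: w' then A i *m Theta w' else Omega [::] *m invmx (f [::]).

Lemma conv_Theta w : conv Theta f w = Omega w.
Proof.
elim: w => [|i w IH] /=; first by rewrite mulmxKV.
by rewrite convMl IH A_Omega addrC.
Qed.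

Lemma Theta_cat u v : Theta (u ++ v) = mxword A u *m Theta v.
Proof.
elim: u => [|i u IH] /=; first by rewrite mxword_nil mul1mx.
by rewrite mxword_cons IH mulmxA.
Qed.

Lemma left_multipleE v :
  left_multiple f v <-> exists n, vanish_above n (fun w => v *m Theta w).
Proof.
split=> [[n [p [hp vp]]]|[n hn]]; exists n.
  move=> w hw; rewrite -(hp w hw).
  apply: (@conv_inj _ (fun w => v *m Theta w) p f f_unit) => u.
  by rewrite convMl conv_Theta.
by exists (fun w => v *m Theta w); split=> // w; rewrite convMl conv_Theta.
Qed.

Lemma evalser_Omega m (Y : 'I_d -> 'M[C]_m) :
  (1%:M - \sum_i tensmx (A i) (Y i)) *m evalser D.+1 Omega Y =
  tensmx (Omega [::] *m invmx (f [::])) 1%:M *m evalser D.+1 f Y.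
Proof.
have ev_widen a (g : ser a K) : vanish_above D g -> evalser D.+1 g Y =
    tensmx (g [::]) 1%:M + \sum_(n < D.+1) \sum_i \sum_(w <- words d n)
      tensmx (g (i :: w)) (Y i *m mxword Y w).
  (* Adding the vanishing degree [D + 1] lets [w] still range over all degrees up to [D] once a
     first letter is split off. *)
  move=> hg; transitivity (evalser D.+2 g Y).
    rewrite /evalser [RHS]big_ord_recr /= -[LHS]addr0; congr (_ + _).
    rewrite big_seq big1 // => w.
    by rewrite mem_words => /eqP hw; rewrite hg ?hw // tens0mx.
  rewrite /evalser big_ord_recl big_words0 mxword_nil; congr (_ + _).
  apply: eq_bigr => n _; rewrite big_wordsS; apply: eq_bigr => i _.
  by apply: eq_bigr => w _; rewrite mxword_cons.
have AA : (\sum_i tensmx (A i) (Y i)) *m evalser D.+1 Omega Y =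
    \sum_(n < D.+1) \sum_i \sum_(w <- words d n)
      tensmx (A i *m Omega w) (Y i *m mxword Y w).
  rewrite /evalser mulmx_sumr; apply: eq_bigr => n _.
  rewrite mulmx_suml; apply: eq_bigr => i _.
  rewrite mulmx_sumr; apply: eq_bigr => w _.
  by rewrite tensmx_mul.
have FF : tensmx (Omega [::] *m invmx (f [::])) 1%:M *m evalser D.+1 f Y =
    tensmx (Omega [::]) 1%:M + \sum_(n < D.+1) \sum_i \sum_(w <- words d n)
      tensmx (Omega [::] *m invmx (f [::]) *m f (i :: w)) (Y i *m mxword Y w).
  rewrite (ev_widen _ f f_deg) mulmxDr tensmx_mul mulmxKV // mul1mx; congr (_ + _).
  rewrite mulmx_sumr; apply: eq_bigr => n _.
  rewrite mulmx_sumr; apply: eq_bigr => i _.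
  rewrite mulmx_sumr; apply: eq_bigr => w _.
  by rewrite tensmx_mul mul1mx.
rewrite mulmxBl mul1mx AA FF (ev_widen _ Omega Omega_deg) -addrA; congr (_ + _).
rewrite -sumrB; apply: eq_bigr => n _; rewrite -sumrB; apply: eq_bigr => i _.
rewrite -sumrB; apply: eq_bigr => w _.
by rewrite A_Omega tensmxDl addrC addKr.
Qed.

(* A row vector fixed by [\sum_i A i (x) Y i] is a polynomial with
   coefficients [xi_w] such that [xi_w = \sum_i xi_(i :: w) (1 (x) Y i)]. *)
Lemma pencil_unit m (Y : 'I_d -> 'M[C]_m) (t : R) :
  (0 < m)%N -> 0 <= t -> t < 1 -> row_contractive t Y ->
  1%:M - \sum_i tensmx (A i) (Y i) \in unitmx.
Proof.
move=> m0 t0 t1 hY; have fY := f_nonsing m0 t0 t1 hY.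
rewrite -row_free_unit -kermx_eq0; apply/eqP/row_matrixP => k.
rewrite row0; move: (row k _) (row_sub k (kermx (1%:M - \sum_i tensmx (A i) (Y i)))).
move=> xi /sub_kermxP xi0.
(* Apply [xi] to [evalser_Omega]: the left side vanishes, and [f(Y)] is invertible. *)
have xiO : xi *m tensmx (Omega [::] *m invmx (f [::])) 1%:M = 0.
  have := congr1 (mulmx xi) (evalser_Omega Y); rewrite mulmxA xi0 mul0mx mulmxA.
  by move=> /esym /(congr1 (mulmxr (invmx (evalser D.+1 f Y)))) /=; rewrite mulmxK // mul0mx.
have xifix : xi = xi *m \sum_i tensmx (A i) (Y i).
  by apply/eqP; rewrite -subr_eq0 -{1}(mulmx1 xi) -mulmxBr xi0.
(* Downward induction on the length of [w]: beyond [D] the coefficients of [Omega] vanish, and the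
   value at [w] is obtained from those at the words [i :: w]. *)
have xiw n w : (D < size w + n)%N -> xi *m tensmx (Omega w) 1%:M = 0.
  elim: n w => [|n IH] w hw; first by rewrite Omega_deg ?tens0mx ?mulmx0 // -(addn0 (size w)).
  rewrite xifix -mulmxA mulmx_suml mulmx_sumr big1 // => i _.
  rewrite tensmx_mul mulmx1 (_ : A i *m Omega w = Omega (i :: w) -
    Omega [::] *m invmx (f [::]) *m f (i :: w)); last by rewrite A_Omega addrK.
  rewrite tensmxDl tensmxNl mulmxBr.
  have -> : tensmx (Omega (i :: w)) (Y i) = tensmx (Omega (i :: w)) 1%:M *m tensmx 1%:M (Y i).
    by rewrite tensmx_mul mulmx1 mul1mx.
  rewrite mulmxA IH ?mul0mx ?sub0r; last by rewrite /= addSnnS.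
  have -> : tensmx (Omega [::] *m invmx (f [::]) *m f (i :: w)) (Y i) =
      tensmx (Omega [::] *m invmx (f [::])) 1%:M *m tensmx (f (i :: w)) (Y i).
    by rewrite tensmx_mul mul1mx.
  by rewrite mulmxA xiO mul0mx oppr0.
pose Z : 'M[C]_(m, N) := \matrix_(l, n) xi 0 (mxtens_index (n, l)).
have xiE : xi = \row_k Z (mxtens_unindex k).2 (mxtens_unindex k).1.
  by apply/rowP => k'; rewrite !mxE -surjective_pairing mxtens_unindexK.
have Z0 : Z = 0.
  apply: Omega_free => w; apply/matrixP => l b.
  have := xiw D.+1 w (leq_addl _ _); rewrite xiE tensmx_row.
  move=> /rowP/(_ (mxtens_index (b, l))).
  by rewrite mxE mxtens_indexK => ->; rewrite !mxE.
by rewrite xiE Z0; apply/rowP => k'; rewrite !mxE.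
Qed.

(** * Action on the quotient of two stable subspaces *)

Section Quotient.
Variables (U W : 'M[C]_N).
Hypothesis U_stable : forall i, (U *m A i <= U)%MS.
Hypothesis W_stable : forall i, (W *m A i <= W)%MS.
Variables (r : nat) (B : 'M[C]_(r, N)) (Q : 'M[C]_(N, r)).
Hypothesis r_gt0 : (0 < r)%N.
Hypothesis BW : (B <= W)%MS.
Hypothesis BQ : B *m Q = 1%:M.
Hypothesis UQ : U *m Q = 0.
Hypothesis WBQ : forall a (V : 'M[C]_(a, N)), (V <= W)%MS -> (V - V *m Q *m B <= U)%MS.

Let X i := B *m A i *m Q.

(** The invertible pencil of [A] preserves [U (x) C^m], hence maps it onto itself by equality of
    ranks. So it is injective modulo this subspace, and on [W] modulo [U] it acts as the pencil of
    [X]. *)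
Lemma quotient_pencil_unit m (Y : 'I_d -> 'M[C]_m) :
  1%:M - \sum_i tensmx (A i) (Y i) \in unitmx ->
  1%:M - \sum_i tensmx (X i) (Y i) \in unitmx.
Proof.
set M := 1%:M - _ => Mu.
pose tI a (V : 'M[C]_(a, N)) := tensmx V (1%:M : 'M[C]_m).
have UM : (tI _ U *m M <= tI _ U)%MS.
  rewrite /M mulmxBr mulmx1 addmx_sub // eqmx_opp mulmx_sumr summx_sub // => i _.
  rewrite /tI tensmx_mul mul1mx; have /submxP[Z ->] := U_stable i.
  have -> : tensmx (Z *m U) (Y i) = tensmx Z (Y i) *m tensmx U 1%:M.
    by rewrite tensmx_mul mulmx1.
  exact: submxMl.
have UMeq : (tI _ U <= tI _ U *m M)%MS.
  rewrite -(geq_leqif (mxrank_leqif_sup UM)) mxrankMfree // row_free_unit //.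
rewrite -row_free_unit -kermx_eq0; apply/eqP/row_matrixP => k.
rewrite row0; move: (row k _) (row_sub k (kermx (1%:M - \sum_i tensmx (X i) (Y i)))).
move=> ze /sub_kermxP ze0.
have h1 : (ze *m tI _ B *m M <= tI _ U)%MS.
  have -> : ze *m tI _ B *m M = ze *m (tI _ B *m M -
      (1%:M - \sum_i tensmx (X i) (Y i)) *m tI _ B).
    by rewrite [RHS]mulmxBr (mulmxA ze (tI _ B)) (mulmxA ze _ (tI _ B)) ze0 mul0mx subr0.
  apply: mulmx_sub; rewrite /M mulmxBr mulmx1 mulmxBl mul1mx opprB addrC addrA subrK.
  rewrite mulmx_sumr mulmx_suml -sumrB summx_sub // => i _.
  rewrite /tI !tensmx_mul mul1mx mulmx1 -tensmxNl -tensmxDl.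
  have /submxP[Z hZ] : (X i *m B - B *m A i <= U)%MS.
    rewrite -opprB eqmx_opp; apply: WBQ.
    by apply: submx_trans (submxMr _ BW) (W_stable i).
  rewrite hZ; have -> : tensmx (Z *m U) (Y i) = tensmx Z (Y i) *m tensmx U 1%:M.
    by rewrite tensmx_mul mulmx1.
  exact: submxMl.
have h2 : (ze *m tI _ B <= tI _ U)%MS.
  have := submx_trans h1 UMeq; rewrite submxMfree // row_free_unit //.
have /submxP[Z hZ] := h2.
rewrite -(mulmx1 ze) -tensmx1 -BQ.
have -> : tensmx (B *m Q) (1%:M : 'M[C]_m) = tI _ B *m tensmx Q 1%:M.
  by rewrite /tI tensmx_mul mulmx1.
by rewrite mulmxA hZ -mulmxA /tI tensmx_mul UQ tens0mx mulmx0.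
Qed.

Lemma quotient_action a (V : 'M[C]_(a, N)) i : (V <= W)%MS ->
  V *m A i *m Q = V *m Q *m X i.
Proof.
move=> VW; have := submxMr (A i) (WBQ VW) => h.
have /submxP[Z hZ] := submx_trans h (U_stable i).
apply/eqP; rewrite -subr_eq0.
have -> : V *m A i *m Q - V *m Q *m X i = (V - V *m Q *m B) *m A i *m Q.
  by rewrite /X !mulmxBl !mulmxA.
by rewrite hZ -mulmxA UQ mulmx0.
Qed.

Hypothesis minimalW : forall W' : 'M[C]_N, (U <= W')%MS -> (W' <= W)%MS ->
  (forall i, (W' *m A i <= W')%MS) -> ~~ (W' <= U)%MS -> (W <= W')%MS.
Hypothesis UW : (U <= W)%MS.

(** A subspace [E] stable under the [X i] lifts to the stable subspace [U + E B] between [U] and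
    [W], to which minimality applies. *)
Lemma quotient_irreducible (E : 'M[C]_r) :
  (forall i, (E *m X i <= E)%MS) -> E != 0 -> row_full E.
Proof.
move=> hE E0; have EBW : (E *m B <= W)%MS by apply: mulmx_sub.
have : (W <= U + E *m B)%MS.
  apply: minimalW; first exact: addsmxSl.
  - by rewrite addsmx_sub UW.
  - move=> i; rewrite addsmxMr addsmx_sub.
    rewrite (submx_trans (U_stable i) (addsmxSl _ _)) /=.
    have EBA : (E *m B *m A i <= W)%MS by apply: submx_trans (submxMr _ EBW) (W_stable i).
    rewrite -[E *m B *m A i](subrK (E *m B *m A i *m Q *m B)) addmx_sub //.
      by apply: submx_trans (WBQ EBA) (addsmxSl _ _).
    rewrite (quotient_action _ EBW) -(mulmxA E B Q) BQ mulmx1.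
    by apply: submx_trans (submxMr _ (hE i)) (addsmxSr _ _).
  apply/negP; rewrite addsmx_sub => /andP[_ /submxP[Z hZ]].
  by move/eqP: E0; apply; rewrite -(mulmx1 E) -BQ mulmxA hZ -mulmxA UQ mulmx0.
move=> h; rewrite -sub1mx -BQ; apply: submx_trans (submxMr Q (submx_trans BW h)) _.
rewrite addsmxMr UQ -(mulmxA E B Q) BQ mulmx1 addsmx_sub sub0mx submx_refl //.
Qed.

(** After the similarity [S] the [X i] form a row contraction, so summing over all words of a given
    length does not increase the norm. Each long word is cut before its last [s = n0 + 1] letters:
    there [U Theta] vanishes, so vectors matter only modulo [U] and the action of [A] becomes that
    of [X]. *)
Lemma level_bound a (V : 'M[C]_(a, N)) n0 : (V <= W)%MS ->
  vanish_above n0 (fun w => U *m Theta w) ->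
  exists c, forall n, lev n (fun w => V *m Theta w) <= c.
Proof.
move=> VW hU.
have [S Su hS] : exists2 S : 'M[C]_r, S \in unitmx &
    forall z : 'rV[C]_r, \sum_i nf (z *m X i *m S) <= nf (z *m S).
  apply: perron_frobenius => //; first exact: quotient_irreducible.
  move=> Y t t0 t1 hY; apply: tensmx_solve; apply: quotient_pencil_unit.
  exact: pencil_unit hY.
have hSM b (Z : 'M[C]_(b, r)) : \sum_i nf (Z *m X i *m S) <= nf (Z *m S).
  rewrite [leRHS]nf_rows; under eq_bigr do rewrite nf_rows.
  rewrite exchange_big; apply: ler_sum => k _; rewrite row_mul.
  by apply: le_trans (hS _); apply: ler_sum => i _; rewrite !row_mul.
have hSw m b (Z : 'M[C]_(b, r)) :
    \sum_(u <- words d m) nf (Z *m mxword X u *m S) <= nf (Z *m S).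
  elim: m Z => [|m IH] Z; first by rewrite big_words0 mxword_nil mulmx1.
  rewrite big_wordsS; apply: le_trans (hSM _ Z); apply: ler_sum => i _.
  under eq_bigr do rewrite mxword_cons mulmxA.
  exact: IH.
have VA u : (V *m mxword A u <= W)%MS /\
    V *m mxword A u *m Q = V *m Q *m mxword X u.
  elim: u V VW => [|i u IH] V' V'W; first by rewrite !mxword_nil !mulmx1.
  have V'A : (V' *m A i <= W)%MS by apply: submx_trans (submxMr _ V'W) (W_stable i).
  have [h1 h2] := IH _ V'A.
  rewrite !mxword_cons (mulmxA V' (A i)) (mulmxA (V' *m Q) (X i)).
  by rewrite -(quotient_action _ V'W).
have VT b (V' : 'M[C]_(b, N)) w : (V' <= W)%MS -> (n0 < size w)%N ->
    V' *m Theta w = V' *m Q *m B *m Theta w.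
  move=> V'W hw; have /submxP[Z hZ] := WBQ V'W.
  apply/eqP; rewrite -subr_eq0 -mulmxBl hZ -mulmxA hU // mulmx0 //.
pose s := n0.+1.
pose c2 := nf (V *m Q *m S) * lev s (fun w => invmx S *m B *m Theta w).
have c20 : 0 <= c2 by rewrite mulr_ge0 ?nf_ge0 ?lev_ge0.
exists (tot s (fun w => V *m Theta w) + c2) => n.
have [ns|sn] := ltnP n s.
  rewrite /tot (bigD1 (Ordinal ns)) //= -addrA lerDl addr_ge0 // sumr_ge0 // => j _.
  exact: lev_ge0.
apply: (@le_trans _ _ c2); last by rewrite lerDr tot_ge0.
rewrite {1}/lev -(subnK sn) big_words_cat.
apply: (@le_trans _ _ (\sum_(u <- words d (n - s)) nf (V *m Q *m mxword X u *m S) *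
    lev s (fun w => invmx S *m B *m Theta w))).
  apply: ler_sum => u _; rewrite /lev mulr_sumr big_seq [leRHS]big_seq.
  apply: ler_sum => w; rewrite mem_words => /eqP hw.
  have [h1 h2] := VA u.
  rewrite Theta_cat mulmxA VT // ?hw // h2.
  apply: le_trans (nfM _ _); rewrite !mulmxA mulmxK //.
by rewrite -mulr_suml ler_wpM2r ?lev_ge0.
Qed.

End Quotient.

(** [U] is the space of multiples of [f], and [W] a stable subspace of least rank strictly above it.
    All of [W] consists of left multiples of [g = sg Omega], in particular [f = h g]; then
    [sg Theta = g f^-1] inverts [h], and [level_bound] controls it. *)
Lemma factor_step : 
  (exists n (p : ser K K), vanish_above n p /\ forall w, conv p f w = one_ser K w) \/
  (exists (nh : nat) (h g : ser K K),
    [/\ vanish_above nh h, vanish_above D g, g [::] = 1%:M,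
        forall w, f w = conv h g w & bounded_inverse h] /\
    [/\ ~ (exists n (p : ser K K), vanish_above n p /\ forall w, conv p h w = one_ser K w),
        forall v, left_multiple f v -> left_multiple g v &
        exists2 v, left_multiple g v & ~ left_multiple f v]).
Proof.
have [U hU] := left_multiple_mx f.
have hUm a (V : 'M[C]_(a, N)) n : vanish_above n (fun w => V *m Theta w) -> (V <= U)%MS.
  move=> hV; apply/row_subP => k; apply/hU/left_multipleE; exists n => w hw.
  by rewrite -row_mul hV // row0.
have [n0 hn0] : exists n0, vanish_above n0 (fun w => U *m Theta w).
  have hk k : exists n, vanish_above n (fun w => row k U *m Theta w).
    by apply/left_multipleE/hU; apply: row_sub.
  have [nk hnk] := choice hk.
  exists (\max_k nk k)%N => w hw; apply/row_matrixP => k.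
  rewrite row_mul row0 hnk //; apply: leq_ltn_trans hw; exact: leq_bigmax.
have U_stable i : (U *m A i <= U)%MS.
  apply: (hUm _ _ n0) => w hw; rewrite -mulmxA -/(Theta (i :: w)) hn0 //=.
  exact: ltnW.
(* If [U] is everything, the constant polynomial 1 is a left multiple of [f]. *)
have [full|nfull] := boolP (1%:M <= U)%MS.
  left; have [|E hE] := @Omega_span K (@one_ser C d K); first by case.
  have [Z hZ] := submxP full.
  exists n0, (fun w => E *m Theta w); split.
    by move=> w hw; rewrite -(mulmx1 E) hZ -!mulmxA hn0 // !mulmx0.
  by move=> w; rewrite convMl conv_Theta hE.
right.
pose okW n := exists W : 'M[C]_N, [/\ (U <= W)%MS, ~~ (W <= U)%MS,
   forall i, (W *m A i <= W)%MS & \rank W = n].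
have ex : exists n, `[< okW n >].
  exists N; apply/asboolP; exists 1%:M; split=> //; rewrite ?submx1 ?mxrank1 //.
  by move=> i; rewrite submx1.
have [rW /asboolP[W [UW WU W_stable rkW]] minW] := ex_minnP ex.
have minimalW (W' : 'M[C]_N) : (U <= W')%MS -> (W' <= W)%MS ->
    (forall i, (W' *m A i <= W')%MS) -> ~~ (W' <= U)%MS -> (W <= W')%MS.
  move=> h1 h2 h3 h4; rewrite -(geq_leqif (mxrank_leqif_sup h2)) rkW.
  by apply: minW; apply/asboolP; exists W'.
(* [Wj] is the space of elements of [W] of degree strictly less than [j]. *)
have hWd j : exists Wj : 'M[C]_N, forall v : 'rV_N, (v <= Wj)%MS <->
    (v <= W)%MS /\ forall w, (j <= size w)%N -> v *m Omega w = 0.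
  apply: subspace_mx; first by split=> [|w _]; rewrite ?sub0mx ?mul0mx.
  move=> a u v [u1 u2] [v1 v2]; split; first by rewrite addmx_sub ?scalemx_sub.
  by move=> w hw; rewrite mulmxDl -scalemxAl u2 // v2 // scaler0 addr0.
have [Wd hWd1] := choice hWd.
have hWdm j a (V : 'M[C]_(a, N)) : (V <= Wd j)%MS <->
    (V <= W)%MS /\ forall w, (j <= size w)%N -> V *m Omega w = 0.
  split=> [h|[h1 h2]].
    have hk k := (hWd1 j _).1 (submx_trans (row_sub k V) h).
    split; first by apply/row_subP => k; case: (hk k).
    move=> w hw; apply/row_matrixP => k; rewrite row_mul row0.
    by case: (hk k) => _; apply.
  apply/row_subP => k; apply/hWd1; split; first exact: submx_trans (row_sub k V) h1.
  by move=> w hw; rewrite -row_mul h2 // row0.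
have mono i j : (i <= j)%N -> (Wd i <= Wd j)%MS.
  move=> ij; have [h1 h2] := (hWdm i _ (Wd i)).1 (submx_refl _).
  by apply/hWdm; split=> // w hw; apply: h2; apply: leq_trans ij hw.
have [sg hsg] := filtered_section (Omega [::]) mono D.+1.
have [F hF] := Omega_span f_deg.
have FU : (F <= U)%MS.
  apply: (hUm _ _ 0%N) => w hw.
  have -> : F *m Theta w = one_ser K w.
    apply: (@conv_inj _ (fun w => F *m Theta w) _ f f_unit) => u.
    by rewrite convMl conv_Theta conv1l hF.
  by case: w hw.
have WD a (V : 'M[C]_(a, N)) : (V <= W)%MS -> (V <= Wd D.+1)%MS.
  by move=> VW; apply/hWdm; split=> // w hw; rewrite Omega_deg // mulmx0.
(* Any constant [c] is the constant term of [c f_0^-1 f], which lies in [U] and so in [W]. *)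
have EO a (c : 'M[C]_(a, K)) : (c <= Wd D.+1 *m Omega [::])%MS.
  have -> : c = c *m invmx (f [::]) *m F *m Omega [::].
    by rewrite -(mulmxA _ F) -hF mulmxKV.
  by apply: submxMr; apply: WD; apply: mulmx_sub; apply: submx_trans FU UW.
have [sg1 sg2] := hsg _ (leqnn _) _ 1%:M (EO _ 1%:M).
rewrite !mul1mx in sg1 sg2.
have sgW : (sg <= W)%MS by case: ((hWdm _ _ _).1 sg1).
pose g w := sg *m Omega w.
have g0 : g [::] = 1%:M by rewrite /g.
(* Division by [g], by induction on the degree. Subtracting [c g], with [c] the constant term, stays
   in [Wd j.+1] because [sg] respects the filtration. The remainder has no constant term, so its
   left derivatives are given by the [A i] and lie in [Wd j]. *)
have gmul j : (j <= D.+1)%N -> forall a (V : 'M[C]_(a, N)), (V <= Wd j)%MS ->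
    exists p : ser a K, vanish_above j p /\ forall w, V *m Omega w = conv p g w.
  elim: j => [|j IH] hj a V hV.
    have [_ h] := (hWdm _ _ _).1 hV.
    by exists (fun=> 0); split=> // w; rewrite h // conv0l.
  have [VW Vdeg] := (hWdm _ _ _).1 hV.
  pose c := V *m Omega [::].
  have [c1 c2] := hsg _ hj _ c (submxMr _ hV).
  pose V' := V - c *m sg.
  have [V'W V'deg] : (V' <= W)%MS /\ forall w, (j.+1 <= size w)%N -> V' *m Omega w = 0.
    by apply/hWdm; rewrite addmx_sub // eqmx_opp.
  have V'0 : V' *m Omega [::] = 0 by rewrite /V' mulmxBl c2 subrr.
  have V'A i w : V' *m Omega (i :: w) = V' *m A i *m Omega w.
    by rewrite A_Omega mulmxDr !mulmxA V'0 !mul0mx addr0.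
  have hp i : exists p : ser a K, vanish_above j p /\
      forall w, V' *m A i *m Omega w = conv p g w.
    apply: IH; first exact: ltnW.
    apply/hWdm; split; first by apply: submx_trans (submxMr _ V'W) (W_stable i).
    by move=> w hw; rewrite -V'A V'deg.
  have [p hp'] := choice hp.
  exists (fun w => if w is i :: w' then p i w' else c); split.
    by case=> [|i w] //= hw; rewrite (hp' i).1.
  case=> [|i w] /=; first by rewrite g0 mulmx1.
  rewrite -(hp' i).2 -V'A /V' mulmxBl /g mulmxA addrC subrK //.
have [h [hdeg hfg]] := gmul _ (leqnn _) _ F (WD _ _ (submx_trans FU UW)).
have gu : g [::] \in unitmx by rewrite g0 unitmx1.
(* After right multiplication by [g], both sides are [sg Theta f = g]. *)
have Sh w : conv (fun w => sg *m Theta w) h w = one_ser K w.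
  apply: (@conv_inj _ (conv (fun w => sg *m Theta w) h) _ g gu) => u.
  rewrite convA conv1l.
  rewrite (@eq_conv _ _ _ _ _ _ (fun w => sg *m Theta w) _ f) //.
    by rewrite convMl conv_Theta.
  by move=> u'; rewrite -hfg -hF.
exists D.+1, h, g; split; first split=> //.
- by move=> w hw; rewrite /g Omega_deg // mulmx0.
- by move=> w; rewrite -hfg -hF.
- have [r [B [Q [r0 BW BQ UQ WBQ]]]] := quotient_coordinates UW WU.
  have [c hc] := level_bound U_stable W_stable r0 BW BQ UQ WBQ minimalW UW sgW hn0.
  by exists (fun w => sg *m Theta w), c; split.
split.
(* A polynomial left inverse [p'] of [h] would give [W Omega = p g = p p' f], so that [W] would lie
   in [U]. *)
- case=> n [p' [hp' hp'1]]; move/negP: WU; apply.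
  have [p [hp hp1]] := gmul _ (leqnn _) _ W (WD _ _ (submx_refl W)).
  apply: (hUm _ _ (D.+1 + n)%N) => w hw.
  have -> : W *m Theta w = conv p p' w.
    apply: (@conv_inj _ (fun w => W *m Theta w) _ f f_unit) => u.
    rewrite convMl conv_Theta hp1 convA; apply: eq_conv => // u'.
    rewrite -(conv1l g) -(eq_conv _ hp'1 (fun=> erefl)) convA.
    by apply: eq_conv => // u''; rewrite -hfg -hF.
  exact: vanish_conv hw.
- move=> v /hU vU.
  have [p [hp hp1]] := gmul _ (leqnn _) _ v (WD _ _ (submx_trans vU UW)).
  by exists D.+1, p.
- have /row_subPn[k hk] := WU; exists (row k W).
    have [p [hp hp1]] := gmul _ (leqnn _) _ _ (WD _ _ (row_sub k W)).
    by exists D.+1, p.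
  by move=> /hU; apply/negP.
Qed.

End Fixed.
End Structure.

(** * Free polynomials as power series *)

Section Bridge.
Variables (R : realType) (d k : nat).
Local Notation C := R[i].
Local Notation word := (seq 'I_d).
Local Notation poly := (freepoly R d k).
Local Notation ser := (word -> 'M[C]_k.+1).
Implicit Types P Q F G : poly.

Definition wcoef P : ser := fun w => mcoeff (FMonom w) P.

Lemma mcoeff_wcoef (m : fmonom 'I_d) P : mcoeff m P = wcoef P m.
Proof. by rewrite /wcoef fmK. Qed.

Lemma wcoef_inj P Q : (forall w, wcoef P w = wcoef Q w) -> P = Q.
Proof. by move=> h; apply/malgP => m; rewrite !mcoeff_wcoef. Qed.

Lemma wcoefB P Q w : wcoef (P - Q) w = wcoef P w - wcoef Q w.
Proof. exact: mcoeffB. Qed.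

Lemma FMonom1 (w : word) : (FMonom w == (mone : fmonom 'I_d)) = (w == [::]).
Proof. by rewrite fmP fm1. Qed.

Lemma wcoef1 w : wcoef 1 w = one_ser k.+1 w.
Proof. by rewrite /wcoef mcoeff1 FMonom1; case: w. Qed.

Lemma deg_leE n P : deg_le n P <-> vanish_above n (wcoef P).
Proof.
split=> h w.
  move=> hw; apply/eqP; rewrite mcoeff_eq0; apply: contraL hw => /h.
  by rewrite -leqNgt.
rewrite -mcoeff_neq0 mcoeff_wcoef; apply: contraNT; rewrite -ltnNge => hw.
by apply/eqP; exact: h.
Qed.

Lemma wcoef_degree P : exists n, vanish_above n (wcoef P).
Proof.
exists (\max_(w <- msupp P) size w)%N; apply/deg_leE => w hw.
by rewrite (big_rem w hw) /= leq_maxl.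
Qed.

Lemma sum_words_single (V : nmodType) n (x : word) (v : word -> V) :
  \sum_(w <- words d n) v w *+ (w == x) = v x *+ (size x == n).
Proof.
have [hx|hx] := boolP (x \in words d n).
  rewrite (bigD1_seq x) ?words_uniq //= eqxx big1 ?addr0.
    by move: hx; rewrite mem_words => ->.
  by move=> w /negPf ->.
rewrite -mem_words (negPf hx) big_seq big1 // => w hw.
by case: eqP => // wx; rewrite -wx hw in hx.
Qed.

Lemma sum_words_degree (V : nmodType) n (x : word) (v : word -> V) : (size x <= n)%N ->
  \sum_(j < n.+1) \sum_(w <- words d j) v w *+ (w == x) = v x.
Proof.
move=> hx; under eq_bigr do rewrite sum_words_single.
rewrite (bigD1 (Ordinal (hx : (size x < n.+1)%N))) //= eqxx big1 ?addr0 //.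
by move=> j /negPf; rewrite -val_eqE /= eq_sym => ->.
Qed.

(** Passes from the support, which is not sorted by degree, to a graded sum over words; words
    outside the support contribute zero. *)
Lemma sum_msupp (V : nmodType) P n (phi : fmonom 'I_d -> V) :
  vanish_above n (wcoef P) -> (forall m, mcoeff m P = 0 -> phi m = 0) ->
  \sum_(m <- msupp P) phi m =
  \sum_(j < n.+1) \sum_(w <- words d j) phi (FMonom w).
Proof.
move=> hP phi0.
have e (w : word) : phi (FMonom w) = \sum_(m <- msupp P) phi m *+ (w == m).
  have [hw|hw] := boolP (FMonom w \in msupp P).
    rewrite (bigD1_seq (FMonom w)) ?fset_uniq //= eqxx big1 ?addr0 // => m hm.
    by move: hm; rewrite fmP /= eq_sym => /negPf ->.
  rewrite phi0; last by apply/eqP; rewrite mcoeff_eq0.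
  rewrite big_seq big1 // => m hm; case: eqP => // wm.
  by rewrite wm fmK hm in hw.
under [RHS]eq_bigr do under eq_bigr do rewrite e.
under [RHS]eq_bigr do rewrite exchange_big.
rewrite exchange_big /=; rewrite big_seq [RHS]big_seq; apply: eq_bigr => m hm.
rewrite (sum_words_degree (fun=> phi m)) //.
by move/deg_leE: hP; apply.
Qed.

Lemma poly_of_ser n (f : ser) : vanish_above n f ->
  exists P, forall w, wcoef P w = f w.
Proof.
move=> hf; exists (\sum_(j < n.+1) \sum_(w <- words d j) mkmalgU (FMonom w) (f w)).
move=> x; rewrite /wcoef raddf_sum /=.
have [hx|hx] := leqP (size x) n.
  rewrite -[RHS](sum_words_degree f hx); apply: eq_bigr => j _.
  by rewrite raddf_sum; apply: eq_bigr => w _; rewrite /= mcoeffU fmP.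
rewrite hf // big1 // => j _; rewrite raddf_sum /= big_seq big1 // => w.
rewrite mem_words => /eqP hw; rewrite mcoeffU fmP /=.
case: eqP => // wx; by move: hx; rewrite -wx hw ltnNge -ltnS ltn_ord.
Qed.

Lemma conv_sum (I J : Type) (s : seq I) (t : seq J) (f : I -> ser) (g : J -> ser) w :
  conv (fun u => \sum_(i <- s) f i u) (fun u => \sum_(j <- t) g j u) w =
  \sum_(i <- s) \sum_(j <- t) conv (f i) (g j) w.
Proof.
rewrite convE; under eq_bigr do rewrite mulmx_suml.
rewrite exchange_big; apply: eq_bigr => i _.
under eq_bigr do rewrite mulmx_sumr.
by rewrite exchange_big; apply: eq_bigr => j _; rewrite convE.
Qed.

Lemma conv_monomial (u v : word) (a b : 'M[C]_k.+1) w :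
  conv (fun x => a *+ (u == x)) (fun x => b *+ (v == x)) w = (a *m b) *+ (u ++ v == w).
Proof.
elim: u w => [|i u IH] w /=.
  rewrite (@eq_conv _ _ _ _ _ _ (fun x => a *m one_ser k.+1 x) _ (fun x => b *+ (v == x))) //.
    by rewrite convMl conv1l; case: eqP => // _; rewrite mulmx0.
  by case=> [|j x]; rewrite ?mulmx1 ?mulmx0.
case: w => [|j w] /=; first by rewrite mul0mx.
rewrite mul0mx add0r eqseq_cons; have [->|ij] := eqVneq i j.
  rewrite -IH; apply: eq_conv => // x; by rewrite eqseq_cons eqxx.
by rewrite conv0l // => x; rewrite eqseq_cons (negPf ij).
Qed.

Lemma wcoefM P Q w : wcoef (P * Q) w = conv (wcoef P) (wcoef Q) w.
Proof.
have e G (x : word) : wcoef G x = \sum_(m <- msupp G) mcoeff m G *+ ((m : word) == x).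
  rewrite {1}(monalgE G) /wcoef raddf_sum; apply: eq_bigr => m _ /=.
  by rewrite mcoeffU fmP.
rewrite (eq_conv w (e P) (e Q)) conv_sum /wcoef mcoeffMl.
apply: eq_bigr => m1 _; apply: eq_bigr => m2 _.
by rewrite conv_monomial fmP fmM.
Qed.

Lemma norm2_sq P n : vanish_above n (wcoef P) -> norm2 P ^+ 2 = tot n.+1 (wcoef P).
Proof.
move=> hP; rewrite /norm2.
have -> : complex.Re (\sum_(w <- msupp P) \tr ((mcoeff w P)^t* *m mcoeff w P)) =
    \sum_(m <- msupp P) nf (mcoeff m P).
  rewrite raddf_sum; apply: eq_bigr => m _ /=.
  by rewrite mxtrace_mulC -nfE.
rewrite sqr_sqrtr; last by apply: sumr_ge0 => m _; apply: nf_ge0.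
by rewrite (sum_msupp hP) // => m ->; rewrite nf0.
Qed.

Lemma evalpolyE F m (X : 'I_d -> 'M[C]_m) n : vanish_above n (wcoef F) ->
  evalpoly F X = evalser n.+1 (wcoef F) X.
Proof.
move=> hF; rewrite /evalpoly (sum_msupp hF) // => w ->; exact: tens0mx.
Qed.

Lemma vanish_aboveW n m (f : ser) : (n <= m)%N -> vanish_above n f -> vanish_above m f.
Proof. by move=> nm h w hw; apply: h; apply: leq_ltn_trans hw. Qed.

Lemma evalpolyD F G m (X : 'I_d -> 'M[C]_m) :
  evalpoly (F + G) X = evalpoly F X + evalpoly G X.
Proof.
have [[n hn] [n' hn']] := (wcoef_degree F, wcoef_degree G).
have hF := vanish_aboveW (leq_maxl n n') hn.
have hG := vanish_aboveW (leq_maxr n n') hn'.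
rewrite (evalpolyE X hF) (evalpolyE X hG) (@evalpolyE _ _ _ (maxn n n')).
  rewrite /evalser -big_split; apply: eq_bigr => j _.
  rewrite -big_split; apply: eq_bigr => w _ /=.
  by rewrite -tensmxDl /wcoef mcoeffD.
by move=> w hw; rewrite /wcoef mcoeffD; rewrite [X in X + _]hF // [X in _ + X]hG // addr0.
Qed.

Lemma evalpoly0 m (X : 'I_d -> 'M[C]_m) : evalpoly (0 : poly) X = 0.
Proof. by rewrite /evalpoly msupp0 big_seq_fset0. Qed.

Lemma evalpolyU (c : 'M[C]_k.+1) w m (X : 'I_d -> 'M[C]_m) :
  evalpoly (mkmalgU w c : poly) X = tensmx c (evalword X w).
Proof.
rewrite /evalpoly msuppU; case: eqP => [->|_].
  by rewrite big_seq_fset0 tens0mx.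
by rewrite big_seq_fset1 mcoeffUU.
Qed.

Lemma evalpolyM F G m (X : 'I_d -> 'M[C]_m) :
  evalpoly (F * G) X = evalpoly F X *m evalpoly G X.
Proof.
have ev_sum (I : Type) (s : seq I) (P : I -> poly) :
    evalpoly (\sum_(i <- s) P i) X = \sum_(i <- s) evalpoly (P i) X.
  exact: (big_morph (fun G' => evalpoly G' X) (fun G' H' => evalpolyD G' H' X) (evalpoly0 X)).
rewrite malgME ev_sum mulmx_suml; apply: eq_bigr => u _.
rewrite ev_sum mulmx_sumr; apply: eq_bigr => v _.
rewrite evalpolyU tensmx_mul; congr tensmx.
by rewrite /evalword fmM big_cat.
Qed.

Lemma evalpoly1 m (X : 'I_d -> 'M[C]_m) : evalpoly (1 : poly) X = 1%:M.
Proof.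
rewrite (_ : 1 = mkmalgU (mone : fmonom 'I_d) 1%:M) // evalpolyU.
by rewrite /evalword fm1 big_nil tensmx1.
Qed.

End Bridge.

(** * The row ball *)

Section RowBall.
Variables (R : realType) (d : nat).
Local Notation C := R[i].

Lemma l2norm_sq m (v : 'cV[C]_m) : l2norm v = Num.sqrt (nf v).
Proof.
rewrite /l2norm /nf; congr Num.sqrt; apply: eq_bigr => i _.
by rewrite normc_sq big_ord1.
Qed.

Lemma opnorm_has_sup m (A : 'M[C]_m) :
  has_sup [set l2norm (A *m v) | v in [set v : 'cV[C]_m | l2norm v <= 1]]%classic.
Proof.
split.
  exists (l2norm (A *m 0)); exists 0 => //=.
  by rewrite l2norm_sq nf0 sqrtr0.
exists (Num.sqrt (nf A)) => _ [v /= hv <-].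
rewrite l2norm_sq; apply: ler_wsqrtr; apply: le_trans (nfM _ _) _.
rewrite ler_piMr ?nf_ge0 //; move: hv; rewrite l2norm_sq -{1}sqrtr1.
by rewrite ler_psqrt ?nnegrE ?nf_ge0.
Qed.

Lemma opnorm_ge0 m (A : 'M[C]_m) : 0 <= opnorm A.
Proof.
apply: le_trans (_ : l2norm (A *m 0) <= _); first exact: sqrtr_ge0.
apply: ub_le_sup; first by case: (opnorm_has_sup A).
by exists 0 => //=; rewrite l2norm_sq nf0 sqrtr0.
Qed.

Lemma opnorm_le m (A : 'M[C]_m) (u : 'cV[C]_m) :
  nf (A *m u) <= opnorm A ^+ 2 * nf u.
Proof.
have [->|u0] := eqVneq u 0; first by rewrite mulmx0 nf0 mulr0.
have nu : 0 < nf u by rewrite lt_def nf_eq0 u0 nf_ge0.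
pose a : R := (Num.sqrt (nf u))^-1.
have na : sqn a%:C%C = (nf u)^-1 by rewrite sqnR exprVn sqr_sqrtr // ltW.
have h : l2norm (A *m (a%:C%C *: u)) <= opnorm A.
  apply: ub_le_sup; first by case: (opnorm_has_sup A).
  exists (a%:C%C *: u) => //=.
  by rewrite l2norm_sq nfZ na mulVf ?gt_eqF // sqrtr1.
move: h; rewrite l2norm_sq -scalemxAr nfZ na => h.
have : (Num.sqrt ((nf u)^-1 * nf (A *m u))) ^+ 2 <= opnorm A ^+ 2.
  by rewrite ler_sqr ?nnegrE ?sqrtr_ge0 ?opnorm_ge0.
by rewrite sqr_sqrtr ?mulr_ge0 ?invr_ge0 ?nf_ge0 // mulrC ler_pdivrMr.
Qed.

Lemma nf_row_form m (v : 'rV[C]_m) (X : 'I_d -> 'M[C]_m) :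
  (\sum_i nf (v *m X i))%:C%C = (v *m (\sum_i X i *m (X i)^t*) *m v^t*) 0 0.
Proof.
rewrite mulmx_sumr mulmx_suml summxE rmorph_sum; apply: eq_bigr => i _ /=.
by rewrite nfE /mxtrace big_ord1 trmx_mul map_mxM !mulmxA.
Qed.

Lemma sqn_dotmx m (v : 'rV[C]_m) (u : 'cV[C]_m) : sqn ((v *m u) 0 0) <= nf v * nf u.
Proof.
have -> : sqn ((v *m u) 0 0) = nf (v *m u) by rewrite /nf !big_ord1.
exact: nfM.
Qed.

(** The constant is the operator norm of [\sum_i X i *m (X i)^t*], the square of the row norm. *)
Lemma rownorm_contractive m (X : 'I_d -> 'M[C]_m) : rownorm X < 1 ->
  exists r : R, [/\ 0 <= r, r < 1 & forall a (V : 'M[C]_(a, m)),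
    \sum_i nf (V *m X i) <= r * nf V].
Proof.
rewrite /rownorm; set M := \sum_i _ => h.
have h0 := opnorm_ge0 M.
exists (opnorm M); split=> //.
  by move: h; rewrite -{1}sqrtr1 ltr_sqrt // ltr01.
have row_case (v : 'rV[C]_m) : \sum_i nf (v *m X i) <= opnorm M * nf v.
  have s0 : 0 <= \sum_i nf (v *m X i) by apply: sumr_ge0 => i _; apply: nf_ge0.
  rewrite -(@ler_pXn2r _ 2) ?nnegrE ?mulr_ge0 ?nf_ge0 // -sqnR nf_row_form -/M.
  rewrite -mulmxA; apply: le_trans (sqn_dotmx _ _) _.
  have -> : (opnorm M * nf v) ^+ 2 = nf v * (opnorm M ^+ 2 * nf v) by ring.
  rewrite ler_wpM2l ?nf_ge0 //.
  by apply: le_trans (opnorm_le _ _) _; rewrite nfJ nf_tr.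
move=> a V; rewrite nf_rows mulr_sumr; under eq_bigr do rewrite nf_rows.
rewrite exchange_big; apply: ler_sum => k _.
by apply: le_trans (row_case _); apply: ler_sum => i _; rewrite row_mul.
Qed.

(** With [M = \sum_i Y_i Y_i^t*] and [w = M u], Cauchy-Schwarz for
    [|w|^2 = \sum_i <Y_i^t* u, Y_i^t* w>] gives [|w|^4 <= t |w|^2 t |u|^2], hence
    [|M u| <= t |u|]. *)
Lemma contractive_rownorm m (Y : 'I_d -> 'M[C]_m) (t : R) : 0 <= t -> t < 1 ->
  (forall v : 'rV_m, \sum_i nf (v *m Y i) <= t * nf v) -> rownorm Y < 1.
Proof.
move=> t0 t1 hY; rewrite /rownorm; set M := \sum_i _.
have hM (u : 'cV[C]_m) : nf (M *m u) <= t ^+ 2 * nf u.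
  set w := M *m u; have [w0|w0] := eqVneq (nf w) 0.
    by rewrite w0 mulr_ge0 ?sqr_ge0 ?nf_ge0.
  have wp : 0 < nf w by rewrite lt_def w0 nf_ge0.
  have e : (nf w)%:C%C = \sum_(p : 'I_d * 'I_m)
      (w^t* *m Y p.1) 0 p.2 * ((Y p.1)^t* *m u) p.2 0.
    rewrite nfE mxtrace_mulC /mxtrace big_ord1 {2}/w /M mulmx_suml mulmx_sumr summxE.
    rewrite -(pair_bigA _ (fun i j => (w^t* *m Y i) 0 j * ((Y i)^t* *m u) j 0)).
    by apply: eq_bigr => i _; rewrite -(mulmxA (Y i)) (mulmxA (w^t*)) [LHS]mxE.
  have := sqn_dot (index_enum ('I_d * 'I_m)%type)
    (fun p => (w^t* *m Y p.1) 0 p.2) (fun p => ((Y p.1)^t* *m u) p.2 0).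
  rewrite -e sqnR.
  rewrite -(pair_bigA _ (fun i j => sqn ((w^t* *m Y i) 0 j))).
  rewrite -(pair_bigA _ (fun i j => sqn (((Y i)^t* *m u) j 0))) /=.
  have -> : \sum_i \sum_j sqn ((w^t* *m Y i) 0 j) = \sum_i nf (w^t* *m Y i).
    by apply: eq_bigr => i _; rewrite /nf big_ord1.
  have -> : \sum_i \sum_j sqn (((Y i)^t* *m u) j 0) = \sum_i nf (u^t* *m Y i).
    apply: eq_bigr => i _.
    have -> : nf (u^t* *m Y i) = nf ((Y i)^t* *m u).
      by rewrite -nf_tr -nfJ trmx_mul map_mxM trmxCK.
    by rewrite /nf; apply: eq_bigr => j _; rewrite big_ord1.
  move=> h; have := ler_pM _ _ (hY (w^t*)) (hY (u^t*)).
  rewrite !nfJ !nf_tr => h2; have {}h2 : nf w ^+ 2 <= t * nf w * (t * nf u).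
    apply: le_trans h (h2 _ _); by apply: sumr_ge0 => i _; apply: nf_ge0.
  rewrite -(ler_pM2l wp) -expr2; apply: le_trans h2 _.
  by rewrite le_eqVlt; apply/orP; left; apply/eqP; ring.
rewrite -sqrtr1 ltr_sqrt ?ltr01 //; apply: le_lt_trans t1.
apply: ge_sup; first by case: (opnorm_has_sup M).
move=> _ [v /= hv <-]; rewrite l2norm_sq -(ger0_norm t0) -sqrtr_sqr.
rewrite ler_psqrt ?nnegrE ?nf_ge0 ?sqr_ge0 //.
apply: le_trans (hM v) _; rewrite ler_piMr ?sqr_ge0 //.
by move: hv; rewrite l2norm_sq -{1}sqrtr1 ler_psqrt ?nnegrE ?nf_ge0.
Qed.

(** Cauchy-Schwarz over words: the squared norms of the [X^w] with [w] of length [n] add up to at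
    most [r^n] times a constant, and the geometric series converges. *)
Lemma evalser_bounded m (X : 'I_d -> 'M[C]_m) : rownorm X < 1 ->
  exists c : R, 0 <= c /\ forall a b N (f : seq 'I_d -> 'M[C]_(a, b)),
    nf (evalser N f X) <= tot N f * c.
Proof.
move=> /rownorm_contractive[r [r0 r1 hr]].
have r1' : 0 < 1 - r by rewrite subr_gt0.
have lw n a (V : 'M[C]_(a, m)) :
    \sum_(w <- words d n) nf (V *m mxword X w) <= r ^+ n * nf V.
  elim: n V => [|n IH] V; first by rewrite big_words0 mxword_nil mulmx1 mul1r.
  rewrite big_wordsS exprSr -mulrA; apply: le_trans (_ : \sum_i r ^+ n * nf (V *m X i) <= _).
    apply: ler_sum => i _; under eq_bigr do rewrite mxword_cons mulmxA.
    exact: IH.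
  by rewrite -mulr_sumr ler_wpM2l ?exprn_ge0.
exists (nf (1%:M : 'M[C]_m) / (1 - r)); split; first by rewrite divr_ge0 ?nf_ge0 // ltW.
move=> a b N f.
have flat (V : nmodType) (phi : seq 'I_d -> V) :
    \sum_(n < N) \sum_(w <- words d n) phi w =
    \sum_(w <- flatten [seq words d n | n <- iota 0 N]) phi w.
  rewrite big_flatten /= big_map -(subn0 N) -/(index_iota 0 N) big_mkord.
  by rewrite subn0.
rewrite /evalser flat; apply: le_trans (nf_tens_sum _ _ _) _.
rewrite -!flat /tot /lev ler_wpM2l //.
  by apply: sumr_ge0 => n _; apply: sumr_ge0 => w _; apply: nf_ge0.
apply: (@le_trans _ _ (\sum_(n < N) r ^+ n * nf (1%:M : 'M[C]_m))).
  apply: ler_sum => n _; apply: le_trans (lw n _ 1%:M).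
  by apply: ler_sum => w _; rewrite mul1mx.
rewrite -mulr_suml mulrC ler_wpM2l ?nf_ge0 //.
rewrite -[leRHS]mul1r ler_pdivlMr // mulrC.
have := subrX1 r N => h; have : (1 - r) * \sum_(i < N) r ^+ i = 1 - r ^+ N.
  by rewrite -[LHS]opprK -mulNr opprB -h opprB.
by move=> ->; rewrite gerBl exprn_ge0.
Qed.

End RowBall.

(** * Optimal approximants *)

Section CoordinateFamily.
Variables (C : fieldType) (d K D : nat).
Local Notation word := (seq 'I_d).
Let T : finType := (D.-bseq 'I_d * 'I_K)%type.

Definition coord_family (w : word) : 'M[C]_(#|T|, K) :=
  \matrix_(n < #|T|, b < K)
    ((((enum_val n : T).1 : word) == w) && ((enum_val n : T).2 == b))%:R.

Lemma coord_familyE a (V : 'M[C]_(a, #|T|)) (s : D.-bseq 'I_d) x b :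
  (V *m coord_family s) x b = V x (enum_rank (s, b)).
Proof.
rewrite mxE (bigD1 (enum_rank (s, b))) //= big1 => [|n hn].
  by rewrite mxE enum_rankK !eqxx mulr1 addr0.
rewrite mxE; case: andP => [[/eqP h1 /eqP h2]|_]; last by rewrite mulr0.
case/eqP: hn; rewrite -(enum_valK n); congr enum_rank.
by case: (enum_val n) h1 h2 => s' b' /= h1 ->; congr pair; apply: val_inj.
Qed.

Lemma coord_family_deg : vanish_above D coord_family.
Proof.
move=> w hw; apply/matrixP => n b; rewrite !mxE.
case: andP => // -[/eqP hn _]; move: hw; rewrite -hn ltnNge.
by rewrite size_bseq.
Qed.

Lemma coord_family_span a (h : word -> 'M[C]_(a, K)) : vanish_above D h ->
  exists V : 'M[C]_(a, #|T|), forall w, h w = V *m coord_family w.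
Proof.
move=> hh; exists (\matrix_(x < a, n < #|T|)
  h ((enum_val n : T).1 : word) x (enum_val n : T).2) => w.
have [hw|hw] := leqP (size w) D; last by rewrite hh // coord_family_deg // mulmx0.
apply/matrixP => x b.
by rewrite (coord_familyE _ (Bseq hw)) mxE enum_rankK.
Qed.

Lemma coord_family_free a (V : 'M[C]_(a, #|T|)) :
  (forall w, V *m coord_family w = 0) -> V = 0.
Proof.
move=> h; apply/matrixP => x n; rewrite mxE -(enum_valK n).
case: (enum_val n) => s b; by rewrite -coord_familyE h mxE.
Qed.

End CoordinateFamily.

(** * Nonsingular polynomials and their factorizations *)

Section Main.
Variables (R : realType) (d k : nat).
Local Notation C := R[i].
Local Notation word := (seq 'I_d).
Local Notation poly := (freepoly R d k).
Local Notation K := k.+1.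
Implicit Types P Q F G H : poly.

Lemma nonsingular_factors H G : nonsingular_row_ball (H * G) ->
  nonsingular_row_ball H /\ nonsingular_row_ball G.
Proof.
move=> h; split=> m X m0 hX; have := h m X m0 hX;
  by rewrite evalpolyM det_mulmx mulf_eq0 negb_or => /andP[].
Qed.

Lemma nonsingular_prod (s : seq poly) G :
  nonsingular_row_ball (\prod_(H <- s) H) -> G \in s -> nonsingular_row_ball G.
Proof.
elim: s => [|H s IH]; first by move=> _; rewrite in_nil => /notF.
rewrite inE big_cons => /nonsingular_factors[hH hs] /orP[/eqP->|]; first exact: hH.
exact: IH.
Qed.

Lemma nonsingular_evalser F n m (Y : 'I_d -> 'M[C]_m) (t : R) :
  nonsingular_row_ball F -> vanish_above n (wcoef F) ->
  (0 < m)%N -> 0 <= t -> t < 1 -> row_contractive t Y ->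
  evalser n.+1 (wcoef F) Y \in unitmx.
Proof.
move=> hF hn m0 t0 t1 hY; rewrite -(evalpolyE Y hn) unitmxE unitfE.
apply: hF m0 _; exact: contractive_rownorm t0 t1 hY.
Qed.

(** Evaluation at the zero tuple of size 1 gives [F_0 (x) 1], whose invertibility passes to the
    constant term [F_0]. *)
Lemma nonsingular_constant_unit F : nonsingular_row_ball F -> wcoef F [::] \in unitmx.
Proof.
move=> hF; have [n hn] := wcoef_degree F.
have := @nonsingular_evalser F n 1 (fun=> 0) 0 hF hn (ltn0Sn 0) (lexx 0) ltr01.
have -> : evalser n.+1 (wcoef F) (fun=> 0 : 'M[C]_1) = tensmx (wcoef F [::]) 1%:M.
  rewrite /evalser big_ord_recl big_words0 mxword_nil big1 ?addr0 // => i _.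
  rewrite big_wordsS big1 // => j _; rewrite big1 // => w _.
  by rewrite mxword_cons mul0mx tensmx0.
have hc : row_contractive 0 (fun _ : 'I_d => 0 : 'M[C]_1).
  by move=> v; rewrite mul0r big1 // => i _; rewrite mulmx0 nf0.
move=> /(_ hc) Tu.
rewrite -row_free_unit -kermx_eq0; apply/eqP/row_matrixP => j; rewrite row0.
move: (row j _) (row_sub j (kermx (wcoef F [::]))) => v /sub_kermxP v0.
have := tensmx_row v (wcoef F [::]); rewrite v0.
set z := \row_k0 _; set z' := \row_k0 _.
have -> : z' = 0 by apply/rowP => i; rewrite !mxE.
move=> /(congr1 (mulmxr (invmx (tensmx (wcoef F [::]) 1%:M)))) /=.
rewrite mulmxK // mul0mx => /rowP hz; apply/rowP => i; rewrite mxE.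
by have := hz (mxtens_index (i, ord0)); rewrite !mxE mxtens_indexK.
Qed.

(** A left inverse [G] is two-sided: [F G F = F], and [F] cancels on the right. *)
Lemma invertible_of_ser F n (p : word -> 'M[C]_K) : wcoef F [::] \in unitmx ->
  vanish_above n p -> (forall w, conv p (wcoef F) w = one_ser K w) -> invertible F.
Proof.
move=> Fu hp hpF; have [G hG] := poly_of_ser hp.
have GF : G * F = 1.
  by apply: wcoef_inj => w; rewrite wcoefM wcoef1 -hpF; apply: eq_conv.
exists G; split; last exact: GF.
apply: wcoef_inj; apply: (conv_inj Fu) => w.
by rewrite -!wcoefM -mulrA GF mulr1 mul1r.
Qed.

Lemma invertible_bounded_inverse F : invertible F -> bounded_inverse (wcoef F).
Proof.
case=> G [_ GF]; have [n hn] := wcoef_degree G.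
exists (wcoef G), (tot n.+1 (wcoef G)); split.
  by move=> w; rewrite -wcoefM GF wcoef1.
move=> m; have [hm|hm] := leqP m n; last by rewrite (lev_vanish hn) ?tot_ge0.
rewrite /tot (bigD1 (Ordinal (hm : (m < n.+1)%N))) //= lerDl sumr_ge0 // => j _.
exact: lev_ge0.
Qed.

(** The inverse is [G' S], and a polynomial factor on the left keeps the levels bounded by
    [lev_conv_l]. *)
Lemma bounded_inverse_mulr H G : bounded_inverse (wcoef H) -> invertible G ->
  bounded_inverse (wcoef (H * G)).
Proof.
case=> S [c [hS hc]] [G' [_ G'G]]; have [n hn] := wcoef_degree G'.
have c0 : 0 <= c by apply: le_trans (hc 0%N); apply: lev_ge0.
exists (conv (wcoef G') S), (n.+1%:R * (tot n.+1 (wcoef G') * c)); split.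
  move=> w; rewrite -wcoef1 -G'G wcoefM convA; apply: eq_conv => // u.
  rewrite (@eq_conv _ _ _ _ _ S S _ (conv (wcoef H) (wcoef G)) u) // => [|x].
    rewrite -convA -[RHS]conv1l; exact: eq_conv.
  exact: wcoefM.
move=> m; apply: le_trans (lev_conv_l _ _ hn) _; rewrite ler_wpM2l //.
apply: (@le_trans _ _ (tot m.+1 (wcoef G') * c)).
  by rewrite /tot mulr_suml; apply: ler_sum => j _; rewrite ler_wpM2l ?lev_ge0.
by rewrite ler_wpM2r // tot_vanish.
Qed.

Section FixedDegree.
Variable D : nat.
Let N := #|((D.-bseq 'I_d * 'I_K)%type : finType)|.
Let Omega : word -> 'M[C]_(N, K) := @coord_family C d K D.

Lemma factor_poly F : vanish_above D (wcoef F) -> nonsingular_row_ball F ->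
  invertible F \/ exists H G,
    [/\ F = H * G, vanish_above D (wcoef G), bounded_inverse (wcoef H) & ~ invertible H] /\
    [/\ forall v, left_multiple Omega (wcoef F) v -> left_multiple Omega (wcoef G) v &
        exists2 v, left_multiple Omega (wcoef G) v & ~ left_multiple Omega (wcoef F) v].
Proof.
move=> hD hF; have Fu := nonsingular_constant_unit hF.
have Odeg : vanish_above D Omega := @coord_family_deg C d K D.
have hA i : exists A : 'M[C]_N, forall w, Omega (i :: w) = A *m Omega w +
    Omega [::] *m invmx (wcoef F [::]) *m wcoef F (i :: w).
  have [|A hA] := @coord_family_span C d K D N (fun w => Omega (i :: w) -
      Omega [::] *m invmx (wcoef F [::]) *m wcoef F (i :: w)).
    by move=> w hw; rewrite Odeg ?(hD (i :: w)) ?mulmx0 ?subr0 //; apply: leqW.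
  by exists A => w; rewrite -[A *m _]hA subrK.
have [A hA'] := choice hA.
have [[n [p [hp pF]]]|] := factor_step Odeg (@coord_family_span C d K D)
    (@coord_family_free C d K D) hD Fu
    (fun m Y t => @nonsingular_evalser F D m Y t hF hD) hA'.
  by left; apply: invertible_of_ser hp pF.
case=> [nh [h [g [[hh hg g0 Fhg hb] [ninv sub str]]]]]; right.
have [H hH] := poly_of_ser hh; have [G hG] := poly_of_ser hg.
have eH : wcoef H = h by apply: funext.
have eG : wcoef G = g by apply: funext.
exists H, G; rewrite eH eG; split=> //; split=> //.
  by apply: wcoef_inj => w; rewrite wcoefM eH eG.
case=> H' [_ H'H]; apply: ninv; have [n hn] := wcoef_degree H'.
exists n, (wcoef H'); split=> // w.
by rewrite -eH -wcoefM H'H wcoef1.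
Qed.

(** Induction on the codimension of the space of left multiples of degree at most [D], which grows
    strictly from [F] to its right factor [G]. *)
Lemma bounded_inverse_factorization F :
  vanish_above D (wcoef F) -> nonsingular_row_ball F ->
  exists s : seq poly, [/\ s != [::], forall G, G \in s -> bounded_inverse (wcoef G)
    & F = \prod_(G <- s) G].
Proof.
have [n] := ubnP (N - \rank (sval (cid (left_multiple_mx Omega (wcoef F)))))%N.
elim: n F => // n IH F hn hD hF.
have [Finv|[H [G [[eF hG hb _] [sub [v vG vF]]]]]] := factor_poly hD hF.
  exists [:: F]; split=> //; last by rewrite big_seq1.
  by move=> G; rewrite inE => /eqP->; apply: invertible_bounded_inverse.
rewrite eF in hF; have [_ Gns] := nonsingular_factors hF.
have [|s [s0 hs eG]] := IH G _ hG Gns.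
  move: hn; case: (cid _) => /= U hU; case: (cid _) => /= U' hU' hn.
  have UU' : (U <= U')%MS.
    by apply/row_subP => i; apply/hU'/sub/hU; apply: row_sub.
  have : (\rank U < \rank U')%N.
    rewrite ltn_neqAle mxrankS // andbT; apply: contra_not_neq vF => rUU'.
    apply/hU; apply: submx_trans (_ : U' <= U)%MS; first exact/hU'.
    by rewrite -(geq_leqif (mxrank_leqif_sup UU')) rUU'.
  have := rank_leq_row U'; move: hn; clear; lia.
exists (H :: s); split=> //; last by rewrite big_cons -eG.
by move=> G'; rewrite inE => /orP[/eqP->|/hs].
Qed.

End FixedDegree.

(** In [F = H G] with [H] not invertible, atomicity forces [G] to be invertible. *)
Lemma atomic_bounded_inverse F : atomic F -> nonsingular_row_ball F ->
  bounded_inverse (wcoef F).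
Proof.
case=> _ Fninv Fatom hF; have [D hD] := wcoef_degree F.
have [//|[H [G [[eF _ hb Hninv] _]]]] := factor_poly hD hF.
rewrite eF; apply: bounded_inverse_mulr => //.
by apply: contrapT => Gninv; apply: Fatom; exists H, G.
Qed.

(** Induction from the right, since [approx_rate_mul] asks for a bounded inverse of the last factor;
    every factor after the first divides the exponent by 3. *)
Lemma prod_rate (s : seq poly) : s != [::] ->
  (forall G, G \in s -> bounded_inverse (wcoef G)) ->
  approx_rate (wcoef (\prod_(G <- s) G)) (1 / 3 ^+ (size s).-1 : R).
Proof.
elim/last_ind: s => // s G IH _ hs.
have hG : bounded_inverse (wcoef G) by apply: hs; rewrite mem_rcons mem_head.
have [D hD] := wcoef_degree G.
have [->|s0] := eqVneq s [::].
  by rewrite big_seq1 expr0 divr1; apply: bounded_inverse_rate hD hG.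
have hs' G' : G' \in s -> bounded_inverse (wcoef G').
  by move=> h; apply: hs; rewrite mem_rcons inE h orbT.
have {}IH := IH s0 hs'.
rewrite -cats1 big_cat big_seq1 size_cat addn1 /=.
have -> : wcoef ((\prod_(G' <- s) G') * G) = conv (wcoef (\prod_(G' <- s) G')) (wcoef G).
  by apply: funext => w; rewrite wcoefM.
case: s s0 IH {hs hs'} => // G0 s _ IH.
rewrite /= exprSr invfM mulrA.
apply: (approx_rate_mul _ _ hD) => //.
- by rewrite divr_gt0 // exprn_gt0.
- by rewrite ler_pdivrMr ?exprn_gt0 // mul1r exprn_ege1 // ler1n.
Qed.

(** * The cost of the optimal approximants *)

Section Cost.
Variables (F : poly) (P : nat -> poly).
Hypothesis hP : forall n, optimal_approximant F n (P n).
Let c n : R := norm2 (P n * F - 1) ^+ 2.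

Lemma rate_cost (p : R) : 0 < p -> approx_rate (wcoef F) p ->
  exists2 c0 : R, 0 <= c0 & forall n, (1 <= n)%N -> c n <= c0 * (1 / n%:R `^ p).
Proof.
move=> p0 [c0 [c00 h]]; exists c0 => // n n1.
have [Q [hQ hM]] := h n; have [Q' hQ'] := poly_of_ser hQ.
have hdeg : deg_le n Q'.
  by apply/deg_leE => w hw; rewrite hQ' hQ.
have n0 : (0 : R) < n%:R by rewrite ltr0n.
apply: (@le_trans _ _ (norm2 (Q' * F - 1) ^+ 2)).
  by rewrite /c ler_sqr ?nnegrE; [exact: (hP n).2 | exact: sqrtr_ge0 | exact: sqrtr_ge0].
have [m hm] := wcoef_degree (Q' * F - 1).
rewrite (norm2_sq hm); apply: le_trans (le_trans (hM m.+1) _).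
  rewrite le_eqVlt; apply/orP; left; apply/eqP; apply: eq_tot => w.
  rewrite wcoefB wcoef1 wcoefM; congr (_ - _); apply: eq_conv => // u.
rewrite ler_wpM2l // mul1r lef_pV2 ?posrE ?powR_gt0 ?ltr0n //.
by apply: ge0_ler_powR; rewrite ?nnegrE ?(ltW p0) ?ler_nat.
Qed.

Lemma cost_to0_nonsingular : (c @ \oo --> (0 : R))%classic -> nonsingular_row_ball F.
Proof.
move=> hc m X m0 hX; apply/negP => /eqP det0.
have [b [b0 hb]] := evalser_bounded hX.
have [u u0 Fu] : exists2 u : 'cV[C]_(K * m), u != 0 & evalpoly F X *m u = 0.
  have : ~~ row_free (evalpoly F X)^T.
    by rewrite row_free_unit unitmxE unitfE det_tr det0 eqxx.
  rewrite -kermx_eq0 => /rowV0Pn[v /sub_kermxP hv v0].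
  exists v^T; first by rewrite -trmx0 (inj_eq trmx_inj).
  by apply: trmx_inj; rewrite trmx_mul trmxK hv trmx0.
have nu : 0 < nf u by rewrite lt_def nf_eq0 u0 nf_ge0.
(* Evaluating [P n * F - 1] at [X] and applying it to [u] gives [- u], so the evaluation has norm at
   least 1. *)
have hn n : 1 <= c n * b.
  have [j hj] := wcoef_degree (P n * F - 1).
  rewrite /c (norm2_sq hj); apply: le_trans (hb _ _ _ _).
  rewrite -(evalpolyE X hj) evalpolyD evalpolyM.
  have hN : evalpoly (- 1 : poly) X = - 1%:M.
    apply/eqP; rewrite -addr_eq0 -(evalpoly1 k X) -evalpolyD addNr.
    by rewrite evalpoly0.
  rewrite -(ler_pM2r nu) mul1r; apply: le_trans (nfM _ _).
  by rewrite mulmxDl -mulmxA Fu mulmx0 add0r hN mulNmx mul1mx nfN.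
have b1 : 0 < b + 1 by rewrite ltr_wpDl.
have ib : 0 < (b + 1)^-1 by rewrite invr_gt0.
move/cvgrPdist_lt: hc => /(_ _ ib)[n _ /(_ n (leqnn n))] /=.
rewrite sub0r normrN ger0_norm ?sqr_ge0 // => cn.
have := hn n; rewrite leNgt => /negP; apply.
apply: (@le_lt_trans _ _ ((b + 1)^-1 * b)); first by rewrite ler_wpM2r // ltW.
by rewrite mulrC ltr_pdivrMr // mul1r ltrDl.
Qed.

Lemma rate_cost_to0 (p : R) : 0 < p -> approx_rate (wcoef F) p ->
  (c @ \oo --> (0 : R))%classic.
Proof.
move=> p0 hF; have [c0 c00 hc] := rate_cost p0 hF.
apply/cvgrPdist_lt => e e0.
(* Chosen so that [x^p = c0 / e]; then every [n > x] works. *)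
pose x : R := (c0 / e) `^ p^-1.
have x0 : 0 <= x by apply: powR_ge0.
have xp : x `^ p = c0 / e.
  by rewrite -powRrM mulVf ?gt_eqF // powRr1 // divr_ge0 // ltW.
exists (Num.truncn x).+1 => // n /= hn.
have xn : x < n%:R.
  have /andP[_ h] := truncn_itv x0.
  by apply: lt_le_trans h _; rewrite ler_nat.
have n1 : (1 <= n)%N by apply: leq_trans hn.
have n0 : (0 : R) < n%:R by rewrite ltr0n.
rewrite sub0r normrN ger0_norm ?sqr_ge0 //.
apply: le_lt_trans (hc n n1) _; rewrite mul1r ltr_pdivrMr ?powR_gt0 //.
rewrite mulrC -ltr_pdivrMr // -xp.
by apply: gt0_ltr_powR; rewrite ?nnegrE.
Qed.

End Cost.
End Main.

(** * The convergence criterion and the decay rates *)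

Local Open Scope classical_set_scope.

Theorem theorem1p1 (R : realType) (d k : nat) (hd : (1 <= d)%N)
    (F : freepoly R d k) (P : nat -> freepoly R d k)
    (hP : forall n : nat, optimal_approximant F n (P n)) :
  let c : nat -> R := fun n => norm2 (P n * F - 1) ^+ 2 in
  [/\ c @ \oo --> (0 : R) <-> nonsingular_row_ball F,
      nonsingular_row_ball F ->
        exists p : R, 0 < p /\ asymp_le c (fun n => 1 / n%:R `^ p) &
      nonsingular_row_ball F -> forall l : nat, (1 <= l)%N ->
        product_of_atoms l F ->
        asymp_le c (fun n => 1 / n%:R `^ (1 / 3 ^+ l.-1))].
Proof.
move=> c.
have pos l : 0 < 1 / 3 ^+ l :> R by rewrite divr_gt0 ?exprn_gt0.
have rate : nonsingular_row_ball F -> exists2 p : R, 0 < p & approx_rate (wcoef F) p.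
  move=> hF; have [D hD] := wcoef_degree F.
  have [s [s0 hs ->]] := bounded_inverse_factorization hD hF.
  by exists (1 / 3 ^+ (size s).-1) => //; apply: prod_rate.
split.
- split; first exact: cost_to0_nonsingular.
  by move=> /rate[p p0 hp]; apply: rate_cost_to0 hp.
- move=> /rate[p p0 hp]; exists p; split=> //.
  by have [c0 _ hc] := rate_cost hP p0 hp; exists c0.
move=> hF l l1 [s [sl satom eF]].
have hs : forall G, G \in s -> bounded_inverse (wcoef G).
  move=> G Gs; apply: atomic_bounded_inverse; first exact: satom.
  by apply: nonsingular_prod Gs; rewrite -eF.
have s0 : s != [::] by rewrite -size_eq0 sl -lt0n.
have := prod_rate s0 hs; rewrite -eF sl => hp.
by have [c0 _ hc] := rate_cost hP (pos l.-1) hp; exists c0.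
Qed.
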